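(* There are constants $\mu_{\sigma,\varrho}$ (depending only on a partition $\sigma$ and on $\varrho\in(0,1]$) and $\widetilde\mu_{n,\varrho}$ (depending only on $n$ and $\varrho$), with $0\le\mu_{\sigma,\varrho}<\widetilde\mu_{n,\varrho}<1$ for every partition $\sigma$ of $n$, such that the following holds. Let $\pi=(n_1,\ldots,n_m)$ be a partition of $n$ and $\mathcal{O}\in\mathcal{B}_{sg}^{(m)}$. Suppose that the chain (in canonical form) connecting $\mathcal{O}$ to $\mathcal{O}''\in\mathcal{B}_{sp}^{(m)}$ contains $d$ shift equivalences. Moreover, suppose that either $\mathcal{O}\stackrel{\mathsf{p}}{\sim}\mathcal{O}'\stackrel{\mathsf{w}}{\sim}\mathcal{O}''\in\mathcal{B}_{sp}^{(m)}$ with $\mathcal{O}'=\mathcal{O}(\mathsf{q})$, or $\mathcal{O}\stackrel{\mathsf{w}}{\sim}\mathcal{O}'\stackrel{\mathsf{p}}{\sim}\mathcal{O}''\in\mathcal{B}_{sp}^{(m)}$ with $\mathcal{O}''=\mathcal{O}'(\mathsf{q})$, for some permutation $\mathsf{q}$ of $\{1,\ldots,m\}$. Then for any $d+1$ block Jacobi operators $\mathcal{J}_1,\mathcal{J}_2,\ldots,\mathcal{J}_{d+1}\in\mathbf{J}_{\mathcal{O}}^{\mathrm{UBCE}_{\pi}(\varrho)}$ one has $$\|\mathcal{J}_1\mathcal{J}_2\cdots\mathcal{J}_{d+1}\|_2\leq\mu_{\pi_{\mathsf{q}},\varrho},\qquad 0\leq\mu_{\pi_{\mathsf{q}},\varrho}<\widetilde{\mu}_{n,\varrho}<1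 .$$
   Context: **Partitions and blocks.** A partition $\pi=(n_1,\ldots,n_m)$ of $n$ ($m\ge 2$) is a tuple of positive integers with $n_1+\cdots+n_m=n$ (order matters). An $n\times n$ matrix is viewed as a block matrix $A=(A_{rs})$ with $A_{rs}$ of size $n_r\times n_s$. For a permutation $\mathsf q$ of $\{1,\dots,m\}$, $\pi_{\mathsf q}=(n_{\mathsf q(1)},\ldots,n_{\mathsf q(m)})$. $\|\cdot\|_2$ is the spectral norm. **Elementary block matrices, UBCE.** For $1\le i<j\le m$ and $\widehat U=\begin{bmatrix} U_{ii} & U_{ij} \\ U_{ji} & U_{jj} \end{bmatrix}$ of order $n_i+n_j$, $\mathcal E(i,j,\widehat U)$ is the $n\times n$ matrix equal to $I_n$ except that its blocks at positions $(i,i),(i,j),(j,i),(j,j)$ are $U_{ii},U_{ij},U_{ji},U_{jj}$. For $0<\varrho\le1$, an orthogonal $\mathcal E(i,j,\widehat U)$ (or $\widehat U$ itself) is in $\mathrm{UBCE}_\pi(\varrho)$ if $\sigma_{\min}(U_{ii})=\sigma_{\min}(U_{jj})\ge\varrho\,\gamma_{ij}$, where $\gamma_{ij}=3/\sqrt{(4^{n_i}+6n_j-1)(n_j+1)}$. **Block Jacobi annihilators and operators.** Let $K=\sum_{r<s}n_rn_s$. For symmetric $A$ of order $n$, $\mathrm{vec}_\pi(A)\in\mathbb R^K$ lists the elements of the blocks $A_{rs}$, $r<s$, in the block order $A_{12},A_{13},A_{23},A_{14},\ldots,A_{m-1,m}$ (by block-columns), each block listed column by column. $\mathcal N_{ij}$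 sets the blocks $(i,i),(i,j),(j,i),(j,j)$ of a matrix to zero. For orthogonal $\widehat U$ of order $n_i+n_j$ and $U=\mathcal E(i,j,\widehat U)$, the $ij$-block Jacobi annihilator is the $K\times K$ matrix $\mathcal R_{ij}(\widehat U)$ defined by $\mathcal R_{ij}(\widehat U)\,\mathrm{vec}_\pi(A)=\mathrm{vec}_\pi(\mathcal N_{ij}(U^TAU))$ for all symmetric $A$ with zero diagonal blocks. For $\mathcal O=(i_0,j_0),\ldots,(i_{T-1},j_{T-1})$, $\mathbf J_{\mathcal O}^{\mathrm{UBCE}_\pi(\varrho)}$ is the set of all products $\mathcal R_{i_{T-1}j_{T-1}}(\widehat U_{T-1})\cdots\mathcal R_{i_1j_1}(\widehat U_1)\mathcal R_{i_0j_0}(\widehat U_0)$ with every $\widehat U_k$ orthogonal and in $\mathrm{UBCE}_\pi(\varrho)$ for the pair $(i_k,j_k)$; its elements are block Jacobi operators. **Pivot sequences and equivalences.** $\mathcal P_m=\{(r,s):1\le r<s\le m\}$; $\mathbf O(\mathcal P_m)$ is the set of finite sequences of elements of $\mathcal P_m$ containing every element at least once; those of length $m(m-1)/2$ are orderings of $\mathcal P_m$. $\mathcal O\sim\mathcal O'$: one is obtained from the other by finitely many transpositions of adjacent terms $(i_r,j_r),(i_{r+1},j_{r+1})$ with $\{i_r,j_r\}\cap\{i_{r+1},j_{r+1}\}=\emptyset$. $\mathcal O\stackrel{\mathsf s}{\sim}\mathcal O'$ (shift equivalence): $\mathcal O=[\mathcal O_1,\mathcal O_2]$, $\mathcal O'=[\mathcal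 O_2,\mathcal O_1]$ (concatenations). $\mathcal O\stackrel{\mathsf w}{\sim}\mathcal O'$ (weak equivalence): there is a finite chain from $\mathcal O$ to $\mathcal O'$ in which adjacent terms are linked by $\sim$ or $\stackrel{\mathsf s}{\sim}$; it can always be written in alternating form $\mathcal O_0\sim\mathcal O_1\stackrel{\mathsf s}{\sim}\mathcal O_2\sim\cdots$ or $\mathcal O_0\stackrel{\mathsf s}{\sim}\mathcal O_1\sim\mathcal O_2\stackrel{\mathsf s}{\sim}\cdots$. $\mathcal O(\mathsf q)=(\mathsf q(i_0),\mathsf q(j_0)),\ldots$, where a pair $(a,b)$ with $a>b$ is replaced by $(b,a)$; $\mathcal O'\stackrel{\mathsf p}{\sim}\mathcal O$ if $\mathcal O'=\mathcal O(\mathsf q)$ for some permutation $\mathsf q$ of $\{1,\ldots,m\}$. A chain is in canonical form if it is a chain of the alternating form $\mathcal O_0\sim\mathcal O_1\stackrel{\mathsf s}{\sim}\mathcal O_2\sim\cdots$ or $\mathcal O_0\stackrel{\mathsf s}{\sim}\mathcal O_1\sim\mathcal O_2\stackrel{\mathsf s}{\sim}\cdots$ with one $\stackrel{\mathsf p}{\sim}$ placed in front of it or behind it. $\mathcal O^{\leftarrow}$ is $\mathcal O$ written in reverse order. **Classes of orderings.** $\mathcal B_c^{(m)}$: orderings $(1,2),(\tau_3(1),3),(\tau_3(2),3),\ldots,(\tau_m(1),m),\ldots,(\tau_m(m-1),m)$ with $\tau_j$ a permutation of $\{1,\ldots,j-1\}$. $\mathcal B_r^{(m)}$: orderings $(m-1,m),(m-2,\widetilde\tau_{m-2}(m-1)),(m-2,\widetilde\tau_{m-2}(m)),\ldots,(1,\widetilde\tau_1(2)),\ldots,(1,\widetilde\tau_1(m))$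 with $\widetilde\tau_i$ a permutation of $\{i+1,\ldots,m\}$. $\mathcal B_{sp}^{(m)}=\{\mathcal O:\ \mathcal O\text{ or }\mathcal O^{\leftarrow}\in\mathcal B_c^{(m)}\cup\mathcal B_r^{(m)}\}$. $\mathcal B_{sg}^{(m)}$ (generalized serial orderings) is the set of $\mathcal O\in\mathbf O(\mathcal P_m)$ such that, for some $\mathcal O'\in\mathbf O(\mathcal P_m)$ and $\mathcal O''\in\mathcal B_{sp}^{(m)}$, either $\mathcal O\stackrel{\mathsf p}{\sim}\mathcal O'\stackrel{\mathsf w}{\sim}\mathcal O''$ or $\mathcal O\stackrel{\mathsf w}{\sim}\mathcal O'\stackrel{\mathsf p}{\sim}\mathcal O''$, the chain being in canonical form. *)

(* Defs.v *)
From HB Require Import structures.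
From Stdlib Require Import Relation_Operators.
From mathcomp Require Import all_boot all_order all_algebra all_fingroup.
From mathcomp Require Import boolp classical_sets reals.

Set Implicit Arguments.
Unset Strict Implicit.
Unset Printing Implicit Defensive.

Import Order.TTheory GRing.Theory Num.Theory.
Local Open Scope ring_scope.

(* Block indices are 0-based: the index i in {1, ..., m} is i - 1
   in 'I_m. A partition (n_1, ..., n_m) is a tuple p : m.-tuple nat, and block
   matrices are those of matrix.v: A : 'M_(\sum_i tnth p i), with
   A_rs = submxblock A r s. *)

Definition is_partition (n m : nat) (p : m.-tuple nat) : Prop :=
  [/\ (2 <= m)%N, (forall i, 0 < tnth p i)%N & (\sum_(i < m) tnth p i)%N = n].

Definition permute_partition m (p : m.-tuple nat) (q : 'S_m) : m.-tuple nat :=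
  [tuple tnth p (q i) | i < m].

Section Norms.
Variable R : realType.

Definition enorm n (x : 'cV[R]_n) : R := Num.sqrt (\sum_i x i 0 ^+ 2).

(* The norm induced by the Euclidean norm. *)
Definition spectral_norm m n (A : 'M[R]_(m, n)) : R :=
  sup [set enorm (A *m x) | x in [set x : 'cV[R]_n | enorm x <= 1]].

Definition singular_value n (A : 'M[R]_n) (s : R) : Prop :=
  0 <= s /\ eigenvalue (A^T *m A) (s ^+ 2).

(* For n >= 1 the set is finite and nonempty, so the infimum is a minimum. *)
Definition sigma_min n (A : 'M[R]_n) : R :=
  inf [set s | singular_value A s].

Definition orthogonal_mx n (U : 'M[R]_n) : Prop := U^T *m U = 1%:M.

End Norms.

Section BlockJacobi.
Variables (R : realType) (m : nat) (p : m.-tuple nat).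

Local Notation order := (\sum_(i < m) tnth p i)%N.

(* For i < j, conform_mx B C is C as soon as C has the size of the block B,
   which is the case in each branch where it is used. *)
Definition elementary (i j : 'I_m) (U : 'M[R]_(tnth p i + tnth p j)) :
    'M[R]_order :=
  \mxblock_(r < m, s < m)
    (let I_rs : 'M[R]_(tnth p r, tnth p s) := submxblock 1%:M r s in
     if (r == i) && (s == i) then conform_mx I_rs (ulsubmx U)
     else if (r == i) && (s == j) then conform_mx I_rs (ursubmx U)
     else if (r == j) && (s == i) then conform_mx I_rs (dlsubmx U)
     else if (r == j) && (s == j) then conform_mx I_rs (drsubmx U)
     else I_rs).

Definition gamma (i j : 'I_m) : R :=
  3 / Num.sqrt ((4 ^+ tnth p i + 6 * (tnth p j)%:R - 1) *
                ((tnth p j)%:R + 1)).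

Definition UBCE (rho : R) (i j : 'I_m) (U : 'M[R]_(tnth p i + tnth p j)) :
    Prop :=
  [/\ orthogonal_mx U,
      sigma_min (ulsubmx U) = sigma_min (drsubmx U)
    & rho * gamma i j <= sigma_min (drsubmx U)].

Definition annihilate_pivot (i j : 'I_m) (A : 'M[R]_order) : 'M[R]_order :=
  \mxblock_(r < m, s < m)
    (if (r \in [:: i; j]) && (s \in [:: i; j]) then 0 else submxblock A r s).

(* 1-based: (1,2), (1,3), (2,3), (1,4), ... *)
Definition upper_pairs : seq ('I_m * 'I_m) :=
  [seq (r, s) | s : 'I_m <- enum 'I_m,
                r : 'I_m <- [seq r : 'I_m <- enum 'I_m | (r < s)%N]].

Definition upper_pair (k : 'I_(size upper_pairs)) : 'I_m * 'I_m :=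
  tnth (in_tuple upper_pairs) k.

(* K = \sum_(r < s) n_r n_s, see vec_dimE; the sum is indexed by the position
   of (r, s) in upper_pairs. *)
Definition vec_dim : nat :=
  (\sum_(k < size upper_pairs)
     tnth p (upper_pair k).2 * tnth p (upper_pair k).1)%N.

Lemma mem_upper_pairs (x : 'I_m * 'I_m) :
  (x \in upper_pairs) = (x.1 < x.2)%N.
Proof.
apply/allpairsPdep/idP => /= [[s [r [_]]]|lt12].
  by rewrite mem_filter => /andP[rs _] ->.
exists x.2, x.1; rewrite !mem_enum mem_filter /= lt12 mem_enum.
by split=> //; exact: surjective_pairing.
Qed.

Lemma upper_pairs_uniq : uniq upper_pairs.
Proof.
apply: allpairs_uniq_dep => [|s _|[s r] [s' r'] _ _ /= [-> ->]//].
  exact: enum_uniq.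
by rewrite filter_uniq ?enum_uniq.
Qed.

Lemma upper_pair_lt k : ((upper_pair k).1 < (upper_pair k).2)%N.
Proof. by rewrite -mem_upper_pairs mem_tnth. Qed.

Lemma upper_pair_inj : injective upper_pair.
Proof. by apply/tuple_uniqP; exact: upper_pairs_uniq. Qed.

Lemma vec_dimE :
  vec_dim = (\sum_(r < m) \sum_(s < m | r < s) tnth p r * tnth p s)%N.
Proof.
rewrite pair_big_dep /= /vec_dim.
transitivity (\sum_(x <- upper_pairs) tnth p x.2 * tnth p x.1)%N.
  by rewrite big_tnth.
rewrite big_uniq ?upper_pairs_uniq //=.
by apply: eq_big => x; rewrite ?mem_upper_pairs // mulnC.
Qed.

(* mxvec lists a matrix row by row, hence the inner transpose. *)
Definition vec (A : 'M[R]_order) : 'cV[R]_vec_dim :=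
  \mxcol_(k < size upper_pairs)
    (mxvec (submxblock A (upper_pair k).1 (upper_pair k).2)^T)^T.

Definition sym_zero_diag (A : 'M[R]_order) : Prop :=
  A^T = A /\ forall r, submxblock A r r = 0.

(* This determines M uniquely, see annihilator_exists, annihilator_unique. *)
Definition is_annihilator (i j : 'I_m) (U : 'M[R]_(tnth p i + tnth p j))
    (M : 'M[R]_vec_dim) : Prop :=
  forall A : 'M[R]_order, sym_zero_diag A ->
    M *m vec A =
    vec (annihilate_pivot i j ((elementary U)^T *m A *m elementary U)).

Let unblock (x : 'cV[R]_vec_dim) (k : 'I_(size upper_pairs)) :
    'M[R]_(tnth p (upper_pair k).1, tnth p (upper_pair k).2) :=
  (vec_mx (submxcol x k)^T)^T.

Let unvec (x : 'cV[R]_vec_dim) : 'M[R]_order :=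
  \mxblock_(r < m, s < m)
    (\sum_(k | upper_pair k == (r, s)) conform_mx 0 (unblock x k) +
     \sum_(k | upper_pair k == (s, r)) conform_mx 0 (unblock x k)^T).

Let upper_pair_index (r s : 'I_m) : (r < s)%N -> exists k, upper_pair k = (r, s).
Proof.
move=> rs; have /tnthP[k ->] : (r, s) \in in_tuple upper_pairs.
  by rewrite mem_upper_pairs.
by exists k.
Qed.

Let upper_pair_gt k (r s : 'I_m) : (s <= r)%N -> (upper_pair k == (r, s)) = false.
Proof.
move=> sr; apply/negP => /eqP E; have := upper_pair_lt k.
by rewrite E /= ltnNge sr.
Qed.

Let unvec_block x k :
  submxblock (unvec x) (upper_pair k).1 (upper_pair k).2 = unblock x k.
Proof.
rewrite mxblockK [X in _ + X]big1 => [|l]; last first.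
  by rewrite upper_pair_gt // ltnW ?upper_pair_lt.
rewrite addr0 (big_pred1 k) => [|l]; first by rewrite conform_mx_id.
by rewrite -surjective_pairing (inj_eq upper_pair_inj).
Qed.

Let unvecK x : vec (unvec x) = x.
Proof.
rewrite -[RHS]submxcolK; apply: eq_mxcol => k.
by rewrite unvec_block /unblock trmxK vec_mxK trmxK.
Qed.

Let conform_trmx a b c d (A : 'M[R]_(a, b)) :
  (conform_mx 0 A : 'M_(c, d))^T = conform_mx 0 A^T.
Proof.
have [ac|nac] := eqVneq a c; last first.
  by rewrite !nonconform_mx ?trmx0 ?nac ?orbT.
have [bd|nbd] := eqVneq b d; last by rewrite !nonconform_mx ?trmx0 ?nbd ?orbT.
by case: _ / ac; case: _ / bd; rewrite !conform_mx_id.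
Qed.

Let unvec_sym x : sym_zero_diag (unvec x).
Proof.
split=> [|r]; last first.
  by rewrite mxblockK !big_pred0 ?addr0 // => k; rewrite upper_pair_gt.
apply/mxblockP => r s; rewrite -tr_submxblock !mxblockK linearD /= addrC.
rewrite !linear_sum /=; congr (_ + _); apply: eq_bigr => k _.
  by rewrite conform_trmx trmxK.
by rewrite conform_trmx.
Qed.

Let sym_ext A B : sym_zero_diag A -> sym_zero_diag B -> vec A = vec B -> A = B.
Proof.
move=> [As A0] [Bs B0]; rewrite /vec => /eq_mxcolP AB.
have up (r s : 'I_m) : (r < s)%N -> submxblock A r s = submxblock B r s.
  case/upper_pair_index => k E; have := AB k; rewrite E /=.
  by move/trmx_inj/(can_inj mxvecK)/trmx_inj.
apply/mxblockP => r s; case: (ltngtP r s) => [/up //|sr|/val_inj ->].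
  by rewrite -As -Bs -!tr_submxblock up.
by rewrite A0 B0.
Qed.

Let submxblock_linear r s :
  linear (fun A : 'M[R]_order => submxblock A r s).
Proof. by move=> a A B; apply/matrixP => u v; rewrite !mxE. Qed.

Let vec_linear : linear vec.
Proof.
move=> a A B; apply/mxcolP => k.
have -> C D : submxcol (a *: C + D : 'cV[R]_vec_dim) k =
              a *: submxcol C k + submxcol D k.
  by apply/matrixP => u v; rewrite !mxE.
by rewrite !mxcolK submxblock_linear !linearP.
Qed.

Let annihilate_linear i j : linear (annihilate_pivot i j).
Proof.
move=> a A B; apply/mxblockP => r s; rewrite submxblock_linear !mxblockK.
by case: ifP => _; rewrite ?scaler0 ?addr0 // submxblock_linear.
Qed.

Let unvec_linear : linear unvec.
Proof.
move=> a x y; apply: sym_ext; first exact: unvec_sym.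
  have [sx dx] := unvec_sym x; have [sy dy] := unvec_sym y.
  split=> [|r]; first by rewrite linearP /= sx sy.
  by rewrite submxblock_linear dx dy scaler0 addr0.
by rewrite vec_linear !unvecK.
Qed.

Lemma annihilator_exists i j (U : 'M[R]_(tnth p i + tnth p j)) :
  exists M, is_annihilator U M.
Proof.
pose f (u : 'rV[R]_vec_dim) : 'rV[R]_vec_dim :=
  (vec (annihilate_pivot i j
          ((elementary U)^T *m unvec u^T *m elementary U)))^T.
have f_lin : linear f.
  move=> a u v; rewrite /f linearP unvec_linear mulmxDr mulmxDl.
  rewrite -scalemxAr -scalemxAl annihilate_linear vec_linear.
  by rewrite linearP.
pose F : {linear 'rV[R]_vec_dim -> 'rV[R]_vec_dim} :=
  HB.pack f (GRing.isLinear.Build _ _ _ _ f f_lin).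
exists (lin1_mx F)^T => A As; apply: trmx_inj.
rewrite trmx_mul trmxK mul_rV_lin1 /= /f trmxK.
by rewrite (sym_ext (unvec_sym _) As (unvecK _)).
Qed.

Lemma annihilator_unique i j (U : 'M[R]_(tnth p i + tnth p j)) M M' :
  is_annihilator U M -> is_annihilator U M' -> M = M'.
Proof.
move=> HM HM'; have E (x : 'cV[R]_vec_dim) : M *m x = M' *m x.
  by rewrite -(unvecK x) HM ?HM' //; exact: unvec_sym.
by apply/trmx_inj/row_matrixP => k; rewrite -!tr_col !colE E.
Qed.

(* The factor of the first pair of the sequence is the rightmost one. *)
Fixpoint jacobi_operator (rho : R) (O : seq ('I_m * 'I_m))
    (J : 'M[R]_vec_dim) : Prop :=
  match O with
  | [::] => J = 1%:M
  | (i, j) :: O' =>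
      exists (U : 'M[R]_(tnth p i + tnth p j)) (M J' : 'M[R]_vec_dim),
        [/\ UBCE rho U, is_annihilator U M, jacobi_operator rho O' J'
          & J = J' *m M]
  end.

End BlockJacobi.

Section PivotSequences.
Variable m : nat.
Implicit Types O : seq ('I_m * 'I_m).

Definition pivot_sequence O : Prop :=
  forall x : 'I_m * 'I_m, (x \in O) = (x.1 < x.2)%N.

Definition adjacent_swap O O' : Prop :=
  exists O1 x y O2,
    [/\ O = O1 ++ [:: x, y & O2], O' = O1 ++ [:: y, x & O2]
      & [disjoint [:: x.1; x.2] & [:: y.1; y.2]]].

Definition equivalent : seq ('I_m * 'I_m) -> seq ('I_m * 'I_m) -> Prop :=
  clos_refl_trans _ adjacent_swap.

Definition shift_equivalent O O' : Prop :=
  exists O1 O2, O = O1 ++ O2 /\ O' = O2 ++ O1.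

Definition relabel (q : 'S_m) O : seq ('I_m * 'I_m) :=
  [seq if (q x.2 < q x.1)%N then (q x.2, q x.1) else (q x.1, q x.2) | x <- O].

Definition perm_equivalent O' O : Prop := exists q : 'S_m, O' = relabel q O.

(* alternating_chain b d O O': an alternating chain from O to O' with d shift
   equivalences, whose first link, if any, is a shift equivalence iff b. *)
Inductive alternating_chain :
    bool -> nat -> seq ('I_m * 'I_m) -> seq ('I_m * 'I_m) -> Prop :=
| chain_nil b O : alternating_chain b 0 O O
| chain_equivalent d O O1 O' :
    equivalent O O1 -> alternating_chain true d O1 O' ->
    alternating_chain false d O O'
| chain_shift d O O1 O' :
    shift_equivalent O O1 -> alternating_chain false d O1 O' ->
    alternating_chain true d.+1 O O'.

(* Weak equivalence through an alternating chain with d shift equivalences. *)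
Definition weakly_equivalent (d : nat) O O' : Prop :=
  exists b, alternating_chain b d O O'.

(* The permutations tau_j are given by the lists of their values. *)
Definition column_ordering O : Prop :=
  exists2 tau : 'I_m -> seq 'I_m,
    forall j, perm_eq (tau j) [seq r : 'I_m <- enum 'I_m | (r < j)%N]
    & O = flatten [seq [seq (r, j) | r <- tau j] | j <- enum 'I_m].

Definition row_ordering O : Prop :=
  exists2 tau : 'I_m -> seq 'I_m,
    forall i, perm_eq (tau i) [seq s : 'I_m <- enum 'I_m | (i < s)%N]
    & O = flatten [seq [seq (i, s) | s <- tau i] | i <- rev (enum 'I_m)].

Definition serial_ordering O : Prop :=
  (column_ordering O \/ row_ordering O) \/
  (column_ordering (rev O) \/ row_ordering (rev O)).

Definition generalized_serial_ordering O : Prop :=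
  pivot_sequence O /\
  exists O' O'' d,
    [/\ pivot_sequence O', serial_ordering O''
      & perm_equivalent O O' /\ weakly_equivalent d O' O'' \/
        weakly_equivalent d O O' /\ perm_equivalent O' O''].

End PivotSequences.

(* Main.v *)
Require Import Defs.
From Stdlib Require Import Relation_Operators.
From mathcomp Require Import boolp classical_sets reals.
From mathcomp Require Import all_boot all_order all_algebra all_fingroup.
From mathcomp Require Import ring lra.

(* All the constants may be taken to depend on [n] and [rho] only, so it is
   enough to bound every admissible product by one number [< 1].

   Write [A |-> N(E^T A E)] for one Jacobi step, acting on symmetric matrices
   with zero diagonal blocks. Conjugation by [E] is a Frobenius isometry that
   commutes with restriction to the pivot blocks, so the squared norm lost in a
   step is the squared norm of the pivot blocks before the step. Suppose that a
   column-wise sweep loses only [eps^2], and look at the phase that annihilates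
   the blocks [(t, j)] for [t] in a set [S] on whose blocks [A] is already of
   size [O(eps)]. Until its own pivot comes, the block [(r, j)] is only
   multiplied by blocks [U_jj], whose singular values are bounded below, up to
   an error [O(eps)]; at its pivot it has norm at most [eps]. Hence it was
   [O(eps)] at the beginning of the phase, and so is [A] on [S + j]. At the end
   of the sweep the whole matrix is [O(eps)], which forces a loss proportional
   to the norm.

   Row-wise sweeps are column-wise for the reversed enumeration of the blocks,
   reversed sweeps are adjoints, relabelling amounts to composing the block
   label of each index with a permutation, steps with disjoint pivots commute,
   and a shift equivalence costs one sweep: [(XY)^(k+1) = X (YX)^k Y]. *)

Set Implicit Arguments.
Unset Strict Implicit.
Unset Printing Implicit Defensive.
Import Order.TTheory GRing.Theory Num.Theory.
Local Open Scope ring_scope.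

(** * Frobenius norm *)

Section Frobenius.
Variable R : rcfType.

Definition fdot m n (A B : 'M[R]_(m, n)) : R := \tr (A^T *m B).

Local Notation fsq A := (fdot A A).

Lemma fdotE m n (A B : 'M[R]_(m, n)) :
  fdot A B = \sum_i \sum_j A i j * B i j.
Proof.
rewrite /fdot /mxtrace exchange_big; apply: eq_bigr => j _.
by rewrite mxE; apply: eq_bigr => i _; rewrite mxE.
Qed.

Lemma fdotC m n (A B : 'M[R]_(m, n)) : fdot A B = fdot B A.
Proof. by rewrite /fdot -mxtrace_tr trmx_mul trmxK. Qed.

Lemma fdotDr m n (A B C : 'M[R]_(m, n)) : fdot A (B + C) = fdot A B + fdot A C.
Proof. by rewrite /fdot mulmxDr mxtraceD. Qed.

Lemma fdotZr m n a (A B : 'M[R]_(m, n)) : fdot A (a *: B) = a * fdot A B.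
Proof. by rewrite /fdot -scalemxAr mxtraceZ. Qed.

Lemma fdotNr m n (A B : 'M[R]_(m, n)) : fdot A (- B) = - fdot A B.
Proof. by rewrite -scaleN1r fdotZr mulN1r. Qed.

Lemma fdotDl m n (A B C : 'M[R]_(m, n)) : fdot (A + B) C = fdot A C + fdot B C.
Proof. by rewrite !(fdotC _ C) fdotDr. Qed.

Lemma fdotZl m n a (A B : 'M[R]_(m, n)) : fdot (a *: A) B = a * fdot A B.
Proof. by rewrite !(fdotC _ B) fdotZr. Qed.

Lemma fdotNl m n (A B : 'M[R]_(m, n)) : fdot (- A) B = - fdot A B.
Proof. by rewrite !(fdotC _ B) fdotNr. Qed.

Lemma fdot_mull m n k (P : 'M[R]_(k, m)) (A : 'M[R]_(m, n)) (B : 'M_(k, n)) :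
  fdot (P *m A) B = fdot A (P^T *m B).
Proof. by rewrite /fdot trmx_mul mulmxA. Qed.

Lemma fdot_mulr m n k (A : 'M[R]_(m, n)) (Q : 'M[R]_(n, k)) (B : 'M_(m, k)) :
  fdot (A *m Q) B = fdot A (B *m Q^T).
Proof. by rewrite /fdot trmx_mul -mulmxA mxtrace_mulC mulmxA. Qed.

Lemma fsq_ge0 m n (A : 'M[R]_(m, n)) : 0 <= fsq A.
Proof.
by rewrite fdotE; do 2! apply: sumr_ge0 => ? _; rewrite -expr2 sqr_ge0.
Qed.

Lemma fsq_eq0 m n (A : 'M[R]_(m, n)) : (fsq A == 0) = (A == 0).
Proof.
apply/idP/eqP => [/eqP A0|->]; last by rewrite /fdot mulmx0 mxtrace0.
apply/matrixP => i j; rewrite mxE; move: A0; rewrite fdotE => /eqP.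
rewrite psumr_eq0 => [/allP /(_ i)|? _]; last first.
  by apply: sumr_ge0 => ? _; rewrite -expr2 sqr_ge0.
rewrite mem_index_enum => /(_ isT); rewrite psumr_eq0 => [/allP /(_ j)|? _].
  by rewrite mem_index_enum mulf_eq0 orbb => /(_ isT)/eqP.
by rewrite -expr2 sqr_ge0.
Qed.

Lemma fsq_tr m n (A : 'M[R]_(m, n)) : fsq A^T = fsq A.
Proof. by rewrite /fdot trmxK mxtrace_mulC. Qed.

Lemma cauchy_schwarz m n (A B : 'M[R]_(m, n)) :
  fdot A B ^+ 2 <= fsq A * fsq B.
Proof.
have [B0|Bn0] := eqVneq B 0.
  by rewrite B0 {1}/fdot mulmx0 mxtrace0 expr0n mulr_ge0 ?fsq_ge0.
have B_gt0 : 0 < fsq B by rewrite lt_def fsq_eq0 Bn0 fsq_ge0.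
(* With [a], [b], [c] as set below, this squared norm is [b * (a * b - c ^+ 2)]. *)
have := fsq_ge0 (fsq B *: A - fdot A B *: B).
rewrite !(fdotDl, fdotDr, fdotNl, fdotNr, fdotZl, fdotZr) (fdotC B A).
set a := fsq A; set b := fsq B in B_gt0 *; set c := fdot A B => H.
rewrite -subr_ge0 -(pmulr_rge0 _ B_gt0).
by apply: le_trans H _; rewrite le_eqVlt; apply/orP; left; apply/eqP; ring.
Qed.

Definition fnorm m n (A : 'M[R]_(m, n)) : R := Num.sqrt (fsq A).

Lemma fnorm_ge0 m n (A : 'M[R]_(m, n)) : 0 <= fnorm A.
Proof. exact: sqrtr_ge0. Qed.

Lemma fnorm_sqr m n (A : 'M[R]_(m, n)) : fnorm A ^+ 2 = fsq A.
Proof. by rewrite sqr_sqrtr ?fsq_ge0. Qed.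

Lemma fnorm_tr m n (A : 'M[R]_(m, n)) : fnorm A^T = fnorm A.
Proof. by rewrite /fnorm fsq_tr. Qed.

Lemma fnorm0 m n : fnorm (0 : 'M[R]_(m, n)) = 0.
Proof. by rewrite /fnorm /fdot mulmx0 mxtrace0 sqrtr0. Qed.

Lemma fnormN m n (A : 'M[R]_(m, n)) : fnorm (- A) = fnorm A.
Proof. by rewrite /fnorm fdotNl fdotNr opprK. Qed.

Lemma ler_fnorm m n k l (A : 'M[R]_(m, n)) (B : 'M[R]_(k, l)) :
  (fnorm A <= fnorm B) = (fsq A <= fsq B).
Proof. by rewrite ler_sqrt ?fsq_ge0. Qed.

Lemma fnorm_le m n (A : 'M[R]_(m, n)) e :
  0 <= e -> (fnorm A <= e) = (fsq A <= e ^+ 2).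
Proof. by move=> e0; rewrite -fnorm_sqr ler_sqr ?nnegrE ?fnorm_ge0. Qed.

Lemma fdot_le_fnorm m n (A B : 'M[R]_(m, n)) : fdot A B <= fnorm A * fnorm B.
Proof.
apply: le_trans (ler_norm _) _.
rewrite -(@ler_sqr _ `|fdot A B|) ?nnegrE ?mulr_ge0 ?fnorm_ge0 //.
by rewrite real_normK ?num_real // exprMn !fnorm_sqr cauchy_schwarz.
Qed.

Lemma fnormD m n (A B : 'M[R]_(m, n)) : fnorm (A + B) <= fnorm A + fnorm B.
Proof.
rewrite fnorm_le ?addr_ge0 ?fnorm_ge0 // fdotDl !fdotDr (fdotC B A).
rewrite sqrrD !fnorm_sqr; have := fdot_le_fnorm A B.
by rewrite -mulr_natr; lra.
Qed.

Lemma fnorm_sum m n (I : Type) (s : seq I) (P : pred I) (F : I -> 'M[R]_(m, n)) :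
  fnorm (\sum_(i <- s | P i) F i) <= \sum_(i <- s | P i) fnorm (F i).
Proof.
elim/big_rec2: _ => [|i u A _ Au]; first by rewrite fnorm0.
by rewrite (le_trans (fnormD _ _)) // lerD2l.
Qed.

Lemma fsq_isom_mull m n k (Q : 'M[R]_(k, m)) (A : 'M[R]_(m, n)) :
  Q^T *m Q = 1%:M -> fsq (Q *m A) = fsq A.
Proof. by move=> Q1; rewrite fdot_mull mulmxA Q1 mul1mx. Qed.

Lemma fsq_isom_mulr m n k (A : 'M[R]_(m, n)) (Q : 'M[R]_(n, k)) :
  Q *m Q^T = 1%:M -> fsq (A *m Q) = fsq A.
Proof. by move=> Q1; rewrite fdot_mulr -mulmxA Q1 mulmx1. Qed.

Lemma fsq_proj_mull m n (P : 'M[R]_m) (A : 'M[R]_(m, n)) :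
  P^T = P -> P *m P = P -> fsq (P *m A) <= fsq A.
Proof.
move=> PT PP; have := fsq_ge0 (A - P *m A).
rewrite !(fdotDl, fdotDr, fdotNl, fdotNr) (fdotC (P *m A) A).
have -> : fdot (P *m A) (P *m A) = fdot A (P *m A).
  by rewrite fdot_mull PT mulmxA PP.
by lra.
Qed.

Lemma fsq_proj_mulr m n (A : 'M[R]_(m, n)) (P : 'M[R]_n) :
  P^T = P -> P *m P = P -> fsq (A *m P) <= fsq A.
Proof.
move=> PT PP; rewrite -fsq_tr trmx_mul PT -(fsq_tr A).
exact: fsq_proj_mull.
Qed.

End Frobenius.
Notation fsq A := (fdot A A).

(** * Block projectors and Jacobi steps *)

Section BlockProjectors.
Variables (R : rcfType) (N m : nat) (b : 'I_N -> 'I_m).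
Implicit Types (x y S : {set 'I_m}) (A E : 'M[R]_N).

(** The partition enters only through the label map [b]: products with these projectors cut out
    blocks without changing the size of the matrix, and a relabelling of the blocks changes nothing
    but [b]. *)
Definition blk x : 'M[R]_N := diag_mx (\row_u (b u \in x)%:R).

Lemma blk_mulE x A y u v :
  (blk x *m A *m blk y) u v = (b u \in x)%:R * A u v * (b v \in y)%:R.
Proof. by rewrite mul_mx_diag mul_diag_mx !mxE. Qed.

Lemma blk_tr x : (blk x)^T = blk x. Proof. exact: tr_diag_mx. Qed.

Lemma blkM x y : blk x *m blk y = blk (x :&: y).
Proof.
apply/matrixP => u v; rewrite /blk mul_diag_mx !mxE inE.
by rewrite mulrnAr -natrM mulnb.
Qed.

Lemma blk_idem x : blk x *m blk x = blk x. Proof. by rewrite blkM setIid. Qed.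

Lemma blk0 : blk set0 = 0.
Proof. by apply/matrixP => u v; rewrite !mxE inE mul0rn. Qed.

Lemma blkT : blk setT = 1%:M.
Proof. by apply/matrixP => u v; rewrite !mxE inE. Qed.

Lemma blkU x y : [disjoint x & y] -> blk (x :|: y) = blk x + blk y.
Proof.
move=> dxy; apply/matrixP => u v; rewrite !mxE inE -mulrnDl; congr (_ *+ _).
have [bx|bx] /= := boolP (b u \in x); last by rewrite add0r.
by rewrite (disjointFr dxy bx) addr0.
Qed.

Lemma blkC x : blk (~: x) = 1%:M - blk x.
Proof.
rewrite -blkT -(setUCr x) blkU ?[_ + blk (~: x)]addrC ?addrK //.
by rewrite -setI_eq0 setICr.
Qed.

Lemma blk_disjoint x y : [disjoint x & y] -> blk x *m blk y = 0.
Proof. by move=> /disjoint_setI0 dxy; rewrite blkM dxy blk0. Qed.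

Lemma blk_sub x y : x \subset y -> blk x *m blk y = blk x.
Proof. by move=> /setIidPl xy; rewrite blkM xy. Qed.

Lemma blk_subr x y : x \subset y -> blk y *m blk x = blk x.
Proof. by move=> /setIidPr xy; rewrite blkM xy. Qed.

Lemma blk_sum x : blk x = \sum_(r in x) blk [set r].
Proof.
apply/matrixP => u v; rewrite summxE mxE [in LHS]mxE.
under eq_bigr do rewrite mxE [in X in X *+ _]mxE inE.
rewrite sumrMnl; congr (_ *+ _).
have [bx|bx] := boolP (b u \in x).
  rewrite (bigD1 (b u)) //= eqxx big1 ?addr0 // => r /andP[_ rb].
  by rewrite eq_sym (negbTE rb).
by rewrite big1 // => r rx; case: eqP => // E; rewrite E rx in bx.
Qed.

Lemma fnorm_blk_sub x x' y y' A : x \subset x' -> y \subset y' ->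
  fnorm (blk x *m A *m blk y) <= fnorm (blk x' *m A *m blk y').
Proof.
move=> xx' yy'; rewrite ler_fnorm.
have -> : blk x *m A *m blk y = blk x *m (blk x' *m A *m blk y') *m blk y.
  by rewrite !mulmxA blk_sub // -!mulmxA blk_subr.
apply: le_trans (fsq_proj_mulr _ (blk_tr _) (blk_idem _)) _.
exact: fsq_proj_mull (blk_tr _) (blk_idem _).
Qed.

Definition kill x A := A - blk x *m A *m blk x.

Lemma killE x A : kill x A = A - blk x *m A *m blk x. Proof. by []. Qed.

(** Pythagoras: the part cut out is an orthogonal projection of [A]. *)
Lemma fsq_kill x A : fsq (kill x A) = fsq A - fsq (blk x *m A *m blk x).
Proof.
have E : fdot A (blk x *m A *m blk x) = fsq (blk x *m A *m blk x).
  rewrite [RHS]fdot_mulr [RHS]fdot_mull !blk_tr -!mulmxA blk_idem !mulmxA.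
  by rewrite blk_idem.
rewrite /kill !(fdotDl, fdotDr, fdotNl, fdotNr) (fdotC _ A) E.
by ring.
Qed.

Lemma fdot_kill x A B : fdot (kill x A) B = fdot A (kill x B).
Proof.
rewrite /kill !(fdotDl, fdotDr, fdotNl, fdotNr).
by rewrite fdot_mulr fdot_mull !blk_tr mulmxA.
Qed.

Lemma kill_tr x A : (kill x A)^T = kill x A^T.
Proof. by rewrite /kill linearB /= !trmx_mul !blk_tr mulmxA. Qed.

Definition sym_off_diag A :=
  A^T = A /\ forall r, blk [set r] *m A *m blk [set r] = 0.

End BlockProjectors.

(** * Rotations of the pivot blocks and the steps they generate *)

Section Rotations.
Variables (R : rcfType) (N m : nat) (b : 'I_N -> 'I_m) (kappa : R).
Implicit Types (x y S : {set 'I_m}) (A E : 'M[R]_N).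
Local Notation blk := (blk R b).
Local Notation kill := (kill b).
Local Notation sym_off_diag := (sym_off_diag b).

(** An abstract form of the orthogonal elementary matrices in the UBCE class: trivial outside the
    pivot blocks [x], with diagonal pivot blocks whose singular values are at least [kappa].
    Recording the bound for [E^T] as well makes the class closed under transposition. *)
Record rotation x E : Prop := Rotation {
  rotation_orth : E^T *m E = 1%:M;
  rotation_out : E *m blk (~: x) = blk (~: x);
  rotation_bound : forall r (X : 'M_N), r \in x ->
    kappa * fnorm (X *m blk [set r]) <=
      fnorm (X *m blk [set r] *m E *m blk [set r]);
  rotation_bound_tr : forall r (X : 'M_N), r \in x ->
    kappa * fnorm (X *m blk [set r]) <=
      fnorm (X *m blk [set r] *m E^T *m blk [set r]) }.

Lemma rotation_tr x E : rotation x E -> rotation x E^T.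
Proof.
case=> EE out bnd bndT; split; rewrite ?trmxK //; first exact: mulmx1C.
by rewrite -{1}out mulmxA EE mul1mx.
Qed.

Lemma rotation_disjointr x y E :
  rotation x E -> [disjoint x & y] -> E *m blk y = blk y.
Proof.
move=> rE dxy; have yx : y \subset ~: x.
  by rewrite -disjoints_subset disjoint_sym.
by rewrite -(blk_subr R b yx) mulmxA rotation_out.
Qed.

Lemma rotation_disjointl x y E :
  rotation x E -> [disjoint x & y] -> blk y *m E = blk y.
Proof.
move=> /rotation_tr rE dxy; apply: trmx_inj.
by rewrite trmx_mul blk_tr (rotation_disjointr rE).
Qed.

Lemma rotation_comm x y E : rotation x E ->
  [disjoint x & y] || (x \subset y) -> E *m blk y = blk y *m E.
Proof.
move=> rE /orP[dxy|xy].
  by rewrite (rotation_disjointr rE) ?(rotation_disjointl rE).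
have dxy : [disjoint x & ~: y] by rewrite disjoints_subset setCK.
rewrite -[y]setCK blkC mulmxBr mulmxBl mulmx1 mul1mx.
by rewrite (rotation_disjointr rE) ?(rotation_disjointl rE).
Qed.

Lemma rotation_kill x y E A : rotation x E ->
  [disjoint x & y] || (x \subset y) ->
  kill y (E^T *m A *m E) = E^T *m kill y A *m E.
Proof.
move=> rE xy; rewrite !killE mulmxBr mulmxBl; congr (_ - _).
rewrite !mulmxA -(rotation_comm (rotation_tr rE) xy) -!mulmxA.
by rewrite (rotation_comm rE xy).
Qed.

Definition step x E A := kill x (E^T *m A *m E).

(** Conjugation by [E] commutes with restriction to its pivot blocks, so the annihilation may come
    first; the norm loss and the adjoint are read off this form. *)
Lemma stepE x E A : rotation x E -> step x E A = E^T *m kill x A *m E.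
Proof. by move=> rE; rewrite /step (rotation_kill _ rE) ?subxx ?orbT. Qed.

Lemma fsq_rotate x E A : rotation x E -> fsq (E^T *m A *m E) = fsq A.
Proof.
move=> rE; have EE : E *m E^T = 1%:M by apply/mulmx1C/(rotation_orth rE).
by rewrite fsq_isom_mulr ?fsq_isom_mull ?trmxK.
Qed.

Lemma fsq_step x E A : rotation x E ->
  fsq (step x E A) = fsq A - fsq (blk x *m A *m blk x).
Proof. by move=> rE; rewrite stepE // (fsq_rotate _ rE) fsq_kill. Qed.

Lemma fdot_step x E A B : rotation x E ->
  fdot (step x E A) B = fdot A (step x E^T B).
Proof.
move=> rE; rewrite stepE // fdot_mulr fdot_mull trmxK fdot_kill.
by rewrite /step trmxK mulmxA.
Qed.

Lemma step_comm x y E F A : rotation x E -> rotation y F -> [disjoint x & y] ->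
  step x E (step y F A) = step y F (step x E A).
Proof.
move=> rE rF dxy; have dyx : [disjoint y & x] by rewrite disjoint_sym.
have fixyF : F *m blk (~: y) = blk (~: y) by exact: rotation_out.
(* On the blocks of [y] the factor [E] is trivial, on the other blocks [F] is; the two halves are
   compared separately. *)
have EF : E *m F = F *m E.
  have splitG G : G = G *m blk y + G *m blk (~: y).
    by rewrite blkC mulmxBr mulmx1 addrC subrK.
  have cx : [disjoint x & ~: y] || (x \subset ~: y).
    by rewrite -disjoints_subset dxy orbT.
  have cy : [disjoint y & y] || (y \subset y) by rewrite subxx orbT.
  rewrite [LHS]splitG [RHS]splitG; congr (_ + _); rewrite -!mulmxA.
    rewrite (rotation_disjointr rE dxy) (rotation_comm rF cy) mulmxA.
    by rewrite (rotation_disjointr rE dxy).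
  by rewrite fixyF (rotation_comm rE cx) mulmxA fixyF.
have killC (G : 'M[R]_N) : kill x (kill y G) = kill y (kill x G).
  rewrite !killE !mulmxBr !mulmxBl.
  have -> : blk x *m (blk y *m G *m blk y) *m blk x = 0.
    by rewrite !mulmxA (blk_disjoint R b dxy) !mul0mx.
  have -> : blk y *m (blk x *m G *m blk x) *m blk y = 0.
    by rewrite !mulmxA (blk_disjoint R b dyx) !mul0mx.
  by rewrite !subr0 addrAC.
rewrite /step -(rotation_kill _ rE) ?dxy // -(rotation_kill _ rF) ?dyx //.
by rewrite killC !mulmxA -!trmx_mul EF -!mulmxA EF.
Qed.

Lemma step_sym_off_diag x E A :
  rotation x E -> sym_off_diag A -> sym_off_diag (step x E A).
Proof.
move=> rE [AT A0]; split.
  by rewrite /step kill_tr !trmx_mul trmxK AT mulmxA.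
move=> r; have [rx|rx] := boolP (r \in x).
  have sx : [set r] \subset x by rewrite sub1set.
  rewrite /step killE mulmxBr mulmxBl !mulmxA (blk_sub R b sx).
  by rewrite -!mulmxA (blk_subr R b sx) subrr.
have dr : [disjoint x & [set r]] by rewrite disjoint_sym disjoints1.
rewrite stepE // !mulmxA (rotation_disjointl (rotation_tr rE) dr).
rewrite -!mulmxA (rotation_disjointr rE dr) !mulmxA killE.
rewrite mulmxBr mulmxBl !mulmxA.
by rewrite (blk_disjoint R b) 1?disjoint_sym // !mul0mx subr0 A0.
Qed.

Definition run (W : seq ({set 'I_m} * 'M[R]_N)) A :=
  foldl (fun A w => step w.1 w.2 A) A W.

Definition rotations (W : seq ({set 'I_m} * 'M[R]_N)) :=
  forall w, w \in W -> rotation w.1 w.2.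

Lemma rotations_cons w W :
  rotations (w :: W) <-> rotation w.1 w.2 /\ rotations W.
Proof.
split=> [rW|[rw rW] v]; last by rewrite inE => /orP[/eqP->|/rW].
by split=> [|v vW]; apply: rW; rewrite inE ?eqxx ?vW ?orbT.
Qed.

Lemma rotations_cat W1 W2 :
  rotations (W1 ++ W2) <-> rotations W1 /\ rotations W2.
Proof.
split=> [rW|[rW1 rW2] v]; last by rewrite mem_cat => /orP[/rW1|/rW2].
by split=> v vW; apply: rW; rewrite mem_cat vW ?orbT.
Qed.

Lemma run_cat W1 W2 A : run (W1 ++ W2) A = run W2 (run W1 A).
Proof. exact: foldl_cat. Qed.

Lemma fsq_run W A : rotations W -> fsq (run W A) <= fsq A.
Proof.
elim: W A => [|w W IH] A //= /rotations_cons[rw rW].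
by rewrite (le_trans (IH _ rW)) // fsq_step // gerBl fsq_ge0.
Qed.

Lemma run_sym_off_diag W A :
  rotations W -> sym_off_diag A -> sym_off_diag (run W A).
Proof.
elim: W A => [|w W IH] A //= /rotations_cons[rw rW] sA.
by apply: IH => //; apply: step_sym_off_diag.
Qed.

(** The word of the adjoint of [run], see [fdot_run]. *)
Definition reverse_word (W : seq ({set 'I_m} * 'M[R]_N)) :=
  rev [seq (w.1, w.2^T) | w <- W].

Lemma reverse_rotations W : rotations W -> rotations (reverse_word W).
Proof.
move=> rW v; rewrite mem_rev => /mapP[w wW ->] /=.
exact/rotation_tr/rW.
Qed.

Lemma fdot_run W A B : rotations W ->
  fdot (run W A) B = fdot A (run (reverse_word W) B).
Proof.
elim: W A B => [|w W IH] A B //= /rotations_cons[rw rW].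
by rewrite IH // fdot_step // /reverse_word map_cons rev_cons -cats1 run_cat.
Qed.

End Rotations.

(** * Contraction along pivot sequences *)

Lemma map_cat_inv (T U : Type) (f : T -> U) W S1 S2 : map f W = S1 ++ S2 ->
  exists W1 W2, [/\ W = W1 ++ W2, map f W1 = S1 & map f W2 = S2].
Proof.
move=> E; exists (take (size S1) W), (drop (size S1) W).
by rewrite cat_take_drop map_take map_drop E take_size_cat ?drop_size_cat.
Qed.

Section Contraction.
Variables (R : rcfType) (N m : nat).
Implicit Types (b : 'I_N -> 'I_m) (kappa c : R) (S : seq {set 'I_m}).

(** The constant bounds squared norms. It is uniform over all rotations with the pivot pattern [S],
    so that later arguments can manipulate the pattern alone. *)
Definition contracts b kappa c S : Prop :=
  forall W A, rotations b kappa W -> map fst W = S -> sym_off_diag b A ->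
    fsq (run b W A) <= c * fsq A.

Lemma contracts_cat b kappa c S1 S S2 : 0 <= c ->
  contracts b kappa c S -> contracts b kappa c (S1 ++ S ++ S2).
Proof.
move=> c0 cS W A rW /map_cat_inv[W1 [W' [EW _]]].
case/map_cat_inv=> [W2 [W3 [EW' W2S _]]] sA; move: rW; rewrite {}EW {}EW'.
case/rotations_cat=> rW1 /rotations_cat[rW2 rW3]; rewrite !run_cat.
apply: le_trans (fsq_run _ rW3) _.
apply: le_trans (cS _ _ rW2 W2S (run_sym_off_diag rW1 sA)) _.
by rewrite ler_wpM2l //; exact: fsq_run rW1.
Qed.

Lemma contracts_swap b kappa c S1 (x y : {set 'I_m}) S2 : [disjoint x & y] ->
  contracts b kappa c (S1 ++ [:: y, x & S2]) ->
  contracts b kappa c (S1 ++ [:: x, y & S2]).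
Proof.
move=> dxy cS W A rW /map_cat_inv[W1 [W' [EW W1S]]] + sA; move: rW; rewrite {}EW.
case: W' => [|[x' E] [|[y' F] W3]] // /rotations_cat[rW1].
case/rotations_cons=> /= rE /rotations_cons[/= rF rW3] [Ex Ey W3S].
rewrite {}Ex in rE *; rewrite {}Ey in rF *.
have := cS (W1 ++ [:: (y, F), (x, E) & W3]) A.
rewrite !run_cat /= (step_comm _ rE rF dxy); apply=> //; last first.
  by rewrite map_cat /= W1S W3S.
apply/rotations_cat; split=> //.
by apply/rotations_cons; split=> //; apply/rotations_cons.
Qed.

(** An operator and its adjoint have the same norm: [fsq Y] is the product of [A] with the adjoint
    word applied to [Y], and after Cauchy-Schwarz one factor [fsq Y] cancels. *)
Lemma contracts_rev b kappa c S : 0 <= c ->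
  contracts b kappa c S -> contracts b kappa c (rev S).
Proof.
move=> c0 cS W A rW WS sA; set Y := run b W A.
have [Y0|Yn0] := eqVneq (fsq Y) 0; first by rewrite Y0 mulr_ge0 ?fsq_ge0.
have Y_gt0 : 0 < fsq Y by rewrite lt_def Yn0 fsq_ge0.
have cY : fsq (run b (reverse_word W) Y) <= c * fsq Y.
  apply: cS; [exact: reverse_rotations | | exact: (run_sym_off_diag rW)].
  rewrite /reverse_word map_rev -map_comp -[S]revK -WS.
  by congr rev; apply: eq_map.
have YE : fsq Y = fdot A (run b (reverse_word W) Y).
  exact: fdot_run rW.
rewrite -(ler_pM2r Y_gt0) -expr2 {1}YE.
apply: le_trans (cauchy_schwarz _ _) _.
by rewrite (mulrC c) -mulrA ler_wpM2l ?fsq_ge0.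
Qed.

Definition pivot (x : 'I_m * 'I_m) : {set 'I_m} := [set x.1; x.2].

Definition sweeps k (O : seq ('I_m * 'I_m)) : seq {set 'I_m} :=
  flatten (nseq k (map pivot O)).

Lemma sweepsS k O : sweeps k.+1 O = map pivot O ++ sweeps k O.
Proof. by []. Qed.

Lemma contracts_equivalent b kappa c k O O1 : equivalent O O1 ->
  contracts b kappa c (sweeps k O1) -> contracts b kappa c (sweeps k O).
Proof.
move=> OO1.
(* One copy of the sequence is rewritten inside an arbitrary context; [gen] then treats the copies
   one after the other. *)
have one S1 S2 : contracts b kappa c (S1 ++ map pivot O1 ++ S2) ->
    contracts b kappa c (S1 ++ map pivot O ++ S2).
  elim: OO1 => // [X Y [O2 [x [y [O3 [-> -> dxy]]]]]|X Y Z _ IH1 _ IH2 H].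
    rewrite !map_cat /= -!catA !cat_cons !catA; apply: contracts_swap.
    apply: disjointWl (disjointWr _ dxy); apply/subsetP => z; rewrite !inE //.
  exact/IH1/IH2.
suff gen S1 : contracts b kappa c (S1 ++ sweeps k O1) ->
    contracts b kappa c (S1 ++ sweeps k O) by exact: (gen [::]).
elim: k S1 => [|k IH] S1 //= H; apply: one; rewrite catA; apply: IH.
by rewrite -catA.
Qed.

Lemma sweeps_shift k X Y : sweeps k.+1 (X ++ Y) =
  map pivot X ++ sweeps k (Y ++ X) ++ map pivot Y.
Proof.
elim: k => [|k IH]; first by rewrite sweepsS /= cats0 map_cat.
by rewrite sweepsS IH sweepsS !map_cat -!catA.
Qed.

(** Equivalences keep the number of sweeps. A shift adds one by [sweeps_shift], since the two outer
    pieces do not increase the norm. *)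
Lemma contracts_chain b kappa c (be : bool) d O O' : 0 <= c ->
  alternating_chain be d O O' -> forall k,
  contracts b kappa c (sweeps k O') -> contracts b kappa c (sweeps (k + d) O).
Proof.
move=> c0; elim=> {be d O O'} [_ O k|d O O1 O' eqO _ IH k cO|d O O1 O'].
- by rewrite addn0.
- exact/(contracts_equivalent eqO)/IH.
case=> X [Y [-> ->]] _ IH k cO; rewrite addnS sweeps_shift.
exact/contracts_cat/IH.
Qed.

Lemma blk_imset b (q : 'S_m) (x : {set 'I_m}) : blk R (q \o b) (q @: x) = blk R b x.
Proof.
by apply/matrixP => u v; rewrite !mxE /= mem_imset //; exact: perm_inj.
Qed.

Lemma blk_imset1 b (q : 'S_m) r : blk R (q \o b) [set q r] = blk R b [set r].
Proof. by rewrite -(blk_imset b q) imset_set1. Qed.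

Lemma rotation_imset b kappa (q : 'S_m) (x : {set 'I_m}) E :
  rotation b kappa x E -> rotation (q \o b) kappa (q @: x) E.
Proof.
case=> EE out bnd bndT; split=> // [|_ X /imsetP[r rx ->]|_ X /imsetP[r rx ->]].
- have -> : ~: (q @: x) = q @: ~: x.
    apply/setP => r; rewrite inE -[r](permKV q) !mem_imset ?inE //;
      exact: perm_inj.
  by rewrite blk_imset.
- by rewrite blk_imset1 bnd.
- by rewrite blk_imset1 bndT.
Qed.

Lemma pivot_relabel (q : 'S_m) O :
  map pivot (relabel q O) = [seq q @: (x : {set 'I_m}) | x <- map pivot O].
Proof.
rewrite -!map_comp; apply: eq_map => x /=; rewrite /pivot imsetU !imset_set1.
by case: ifP => _ //=; rewrite setUC.
Qed.

(** The matrices stay and only the names of the blocks change: [O] with labels [b] and [relabel q O]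
    with labels [q \o b] describe the same steps. *)
Lemma contracts_relabel b kappa c (q : 'S_m) k O :
  contracts (q \o b) kappa c (sweeps k (relabel q O)) ->
  contracts b kappa c (sweeps k O).
Proof.
move=> cO W A rW WO sA; pose W' := [seq (q @: (w.1 : {set 'I_m}), w.2) | w <- W].
have -> : run b W A = run (q \o b) W' A.
  rewrite /W'; elim: (W) A {sA} => [|w V IH] A //=.
  by rewrite IH /step !killE blk_imset.
apply: cO; first by move=> _ /mapP[w wW ->]; exact/rotation_imset/rW.
  rewrite /W' -map_comp /sweeps pivot_relabel -map_nseq -map_flatten -/(sweeps _ _).
  by rewrite -WO -map_comp.
case: sA => AT A0; split=> // r.
by rewrite -[r](permKV q) blk_imset1.
Qed.

End Contraction.

(** * Column-wise sweeps *)

Section ColumnSweep.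
Variables (R : rcfType) (N m : nat) (b : 'I_N -> 'I_m) (kappa : R).
Hypothesis kappa_gt0 : 0 < kappa.
Hypothesis kappa_le1 : kappa <= 1.
Implicit Types (S : {set 'I_m}) (A : 'M[R]_N).
Local Notation blk := (blk R b).
Local Notation rotation := (rotation b kappa).
Local Notation rotations := (rotations b kappa).
Local Notation step := (step b).
Local Notation run := (run b).

Lemma blk_step_out x E A r s : rotation x E -> r \notin x -> s \notin x ->
  blk [set r] *m step x E A *m blk [set s] = blk [set r] *m A *m blk [set s].
Proof.
move=> rE rx sx; have dr : [disjoint x & [set r]].
  by rewrite disjoint_sym disjoints1.
have ds : [disjoint x & [set s]] by rewrite disjoint_sym disjoints1.
rewrite (stepE _ rE) !mulmxA (rotation_disjointl (rotation_tr rE) dr).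
rewrite -!mulmxA (rotation_disjointr rE ds) !mulmxA killE mulmxBr mulmxBl.
by rewrite !mulmxA (blk_disjoint R b) 1?disjoint_sym // !mul0mx subr0.
Qed.

(** The new block [(r, j)] is the sum of the old blocks [(r, t)] and [(r, j)], each multiplied by a
    block of [E]. The factor of [(r, j)] is a diagonal block, bounded below by [kappa]; the other
    factor does not increase norms. *)
Lemma blk_step_in t j E A r : rotation [set t; j] E -> t != j ->
  r \notin [set t; j] ->
  kappa * fnorm (blk [set r] *m A *m blk [set j]) <=
    fnorm (blk [set r] *m step [set t; j] E A *m blk [set j]) +
    fnorm (blk [set r] *m A *m blk [set t]).
Proof.
move=> rE tj rx; set x := [set t; j] in rE rx *.
have dr : [disjoint x & [set r]] by rewrite disjoint_sym disjoints1.
have jx : [set j] \subset x by rewrite sub1set !inE eqxx orbT.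
have xE : E *m blk [set j] = blk [set t] *m E *m blk [set j] +
                             blk [set j] *m E *m blk [set j].
  rewrite -!mulmxDl -blkU ?disjoints1 ?inE // -/x.
  rewrite -(rotation_comm rE) ?subxx ?orbT // -mulmxA.
  by rewrite (blk_subr R b jx).
have -> : blk [set r] *m step x E A *m blk [set j] =
          blk [set r] *m A *m blk [set t] *m (E *m blk [set j]) +
          blk [set r] *m A *m blk [set j] *m E *m blk [set j].
  rewrite (stepE _ rE) !mulmxA (rotation_disjointl (rotation_tr rE) dr).
  rewrite killE mulmxBr !mulmxBl !mulmxA.
  rewrite (blk_disjoint R b (x := [set r])) 1?disjoint_sym // !mul0mx subr0.
  by rewrite -!mulmxA [in LHS]xE !mulmxDr !mulmxA.
set Z := blk [set r] *m A *m blk [set t].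
apply: le_trans (rotation_bound rE _ _) _; first by rewrite !inE eqxx orbT.
set Y := _ *m E *m _.
(* Reverse triangle inequality: [Y] is the new block minus the contribution of [Z]. *)
have {1}-> : Y = (Z *m (E *m blk [set j]) + Y) - Z *m (E *m blk [set j]).
  by rewrite addrAC subrr add0r.
apply: le_trans (fnormD _ _) _; rewrite fnormN lerD2l ler_fnorm mulmxA.
apply: le_trans (fsq_proj_mulr _ (blk_tr _ _ _) (blk_idem _ _ _)) _.
by rewrite fsq_isom_mulr //; apply/mulmx1C/(rotation_orth rE).
Qed.

(** Induction on [tau]. The first block [(t, j)] lies in the pivot blocks, so its squared norm is
    part of the loss. For a later [r] the induction hypothesis bounds the block after the first
    step, and [blk_step_in] carries the bound back, adding [B] and dividing by [kappa]. Blocks with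
    both indices in the rest of [tau] do not change in that step. *)
Lemma phase_bound j (eps B : R) tau W A : 0 <= eps -> 0 <= B ->
  uniq tau -> j \notin tau ->
  map fst W = [seq [set t; j] | t <- tau] -> rotations W ->
  (forall r s, r \in tau -> s \in tau ->
     fnorm (blk [set r] *m A *m blk [set s]) <= B) ->
  fsq A - fsq (run W A) <= eps ^+ 2 ->
  forall r, r \in tau -> fnorm (blk [set r] *m A *m blk [set j]) <=
    (eps + (size tau)%:R * B) / kappa ^+ size tau.
Proof.
move=> eps0 B0; elim: tau W A => [|t tau IH] W A //= /andP[ttau utau].
rewrite inE negb_or => /andP[jt jtau].
case: W => [|[x E] W] //= [Ex EW] /rotations_cons[/= rE rW] AB loss.
rewrite {}Ex in rE loss *.
have K_gt0 k : 0 < kappa ^+ k by rewrite exprn_gt0.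
have loss1 := fsq_step A rE; have lossW := fsq_run (step [set t; j] E A) rW.
move=> r; rewrite inE => /orP[/eqP->|rtau].
  have tx : [set t] \subset [set t; j] by rewrite sub1set !inE eqxx.
  have jx : [set j] \subset [set t; j] by rewrite sub1set !inE eqxx orbT.
  apply: (@le_trans _ _ eps).
    apply: le_trans (fnorm_blk_sub b A tx jx) _.
    rewrite fnorm_le //; move: loss loss1 lossW.
    by set u := fsq (run _ _); set v := fsq (step _ _ _); lra.
  rewrite ler_pdivlMr //; apply: (@le_trans _ _ eps).
    by rewrite ler_piMr // exprn_ile1 // ltW.
  by rewrite lerDl mulr_ge0.
have notin s : s \in tau -> s \notin [set t; j].
  move=> st; rewrite !inE negb_or; apply/andP; split.
    by apply: contraNneq ttau => <-.
  by apply: contraNneq jtau => <-.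
have := IH W (step [set t; j] E A) utau jtau EW rW.
have AB' s s' : s \in tau -> s' \in tau ->
    fnorm (blk [set s] *m step [set t; j] E A *m blk [set s']) <= B.
  move=> st s't; rewrite (blk_step_out _ rE) ?notin //.
  by apply: AB; rewrite inE ?st ?s't orbT.
have loss' : fsq (step [set t; j] E A) - fsq (run W (step [set t; j] E A)) <=
    eps ^+ 2.
  have := fsq_ge0 (blk [set t; j] *m A *m blk [set t; j]).
  move: loss loss1; set u := fsq (run _ _); set v := fsq (step _ _ _); lra.
move=> /(_ AB' loss' r rtau) bnd.
have tj : t != j by rewrite eq_sym.
have := blk_step_in A rE tj (notin _ rtau).
have : fnorm (blk [set r] *m A *m blk [set t]) <= B.
  by apply: AB; rewrite inE ?rtau ?eqxx ?orbT.
move: bnd; set u := fnorm (_ *m A *m blk [set t]).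
set v := fnorm (_ *m A *m _); set w := fnorm _; set K := kappa ^+ size tau.
have K0 : 0 < K by exact: K_gt0.
rewrite exprS -/K !ler_pdivlMr ?mulr_gt0 // => wK uB vwu.
have uK : u * K <= B.
  apply: le_trans uB; rewrite ler_piMr ?fnorm_ge0 ?exprn_ile1 ?(ltW kappa_gt0) //.
have := ler_wpM2r (ltW K0) vwu. rewrite -natr1.
by move: wK uK; rewrite !mulrDl mul1r; lra.
Qed.

(* The set argument collects the indices whose columns are already swept;
   the sequence lists the pivots that remain. *)
Inductive column_sweep : {set 'I_m} -> seq {set 'I_m} -> Prop :=
| column_sweep_done : column_sweep setT [::]
| column_sweep_phase S j tau L :
    j \notin S -> uniq tau -> tau =i S -> column_sweep (j |: S) L ->
    column_sweep S ([seq [set t; j] | t <- tau] ++ L).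

(** Restriction to the blocks of [S] commutes with steps whose pivots lie in [S], so the restricted
    matrix undergoes the same steps. *)
Lemma fnorm_run_lead S W A : rotations W ->
  (forall w, w \in W -> w.1 \subset S) ->
  fnorm (blk S *m run W A *m blk S) <= fnorm (blk S *m A *m blk S).
Proof.
elim: W A => [|[x E] W IH] A //= /rotations_cons[/= rE rW] WS.
apply: le_trans (IH _ rW _) _ => [w wW|]; first by apply: WS; rewrite inE wW orbT.
have xS : x \subset S by apply: (WS (x, E)); rewrite inE eqxx.
have cS : [disjoint x & S] || (x \subset S) by rewrite xS orbT.
rewrite ler_fnorm.
have -> : blk S *m step x E A *m blk S = step x E (blk S *m A *m blk S).
  rewrite !(stepE _ rE) !mulmxA -(rotation_comm (rotation_tr rE) cS).
  rewrite -!mulmxA (rotation_comm rE cS) !mulmxA; congr (_ *m E).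
  rewrite -!mulmxA; congr (_ *m _); rewrite !killE mulmxBl mulmxBr !mulmxA.
  rewrite !(blk_sub R b xS, blk_subr R b xS) -!mulmxA.
  by rewrite !(blk_sub R b xS, blk_subr R b xS).
by rewrite (fsq_step _ rE) gerBl fsq_ge0.
Qed.

(* One phase enlarges the bound [beta * eps] on the leading block to
   [growth n beta * eps]; see [phase_lead]. *)
Definition growth (n : nat) (beta : R) : R :=
  beta + 2 * (n%:R * ((1 + n%:R * beta) / kappa ^+ n)).

Lemma growth_ge n beta : 0 <= beta -> beta <= growth n beta.
Proof.
move=> beta0; rewrite lerDl mulr_ge0 // mulr_ge0 // divr_ge0 //.
  by rewrite addr_ge0 // mulr_ge0.
by rewrite exprn_ge0 // ltW.
Qed.

(** The enlarged block consists of the block on [S], the column [j], controlled by [phase_bound],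
    and the transpose of that column; the diagonal block at [j] vanishes. An upper bound [n]
    replaces [m] so that the constant is common to all partitions of [n]. *)
Lemma phase_lead n S j tau W A (eps beta : R) : (m <= n)%N -> 0 <= eps -> 0 <= beta ->
  j \notin S -> uniq tau -> tau =i S ->
  map fst W = [seq [set t; j] | t <- tau] -> rotations W -> sym_off_diag b A ->
  fsq A - fsq (run W A) <= eps ^+ 2 ->
  fnorm (blk S *m A *m blk S) <= beta * eps ->
  fnorm (blk (j |: S) *m A *m blk (j |: S)) <= growth n beta * eps.
Proof.
move=> mn eps0 beta0 jS utau tauS WS rW [AT A0] loss lead.
have dj : [disjoint [set j] & S] by rewrite disjoints1.
have B0 : 0 <= beta * eps by rewrite mulr_ge0.
have size_tau : (size tau <= n)%N.
  apply: leq_trans mn; rewrite -[X in (_ <= X)%N]card_ord -(card_uniqP utau).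
  exact: max_card.
have K_gt0 k : 0 < kappa ^+ k by rewrite exprn_gt0.
have bound r : r \in S -> fnorm (blk [set r] *m A *m blk [set j]) <=
    (1 + n%:R * beta) / kappa ^+ n * eps.
  rewrite -tauS => rtau; have jtau : j \notin tau by rewrite tauS.
  have AB s s' : s \in tau -> s' \in tau ->
      fnorm (blk [set s] *m A *m blk [set s']) <= beta * eps.
    rewrite !tauS => sS s'S; apply: le_trans lead.
    by apply: fnorm_blk_sub; rewrite sub1set.
  have := phase_bound eps0 B0 utau jtau WS rW AB loss rtau.
  (* Passing from [size tau] to [n] raises the numerator, and lowers the denominator because
     [kappa <= 1]. *)
  move/le_trans; apply.
  have -> : (1 + n%:R * beta) / kappa ^+ n * eps =
            (eps + n%:R * (beta * eps)) / kappa ^+ n.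
    by rewrite mulrAC mulrDl mul1r -(mulrA n%:R).
  apply: ler_pM; rewrite ?invr_ge0 ?(ltW (K_gt0 _)) //.
  - by rewrite addr_ge0 // mulr_ge0.
  - by rewrite lerD2l ler_wpM2r // ler_nat.
  by rewrite lef_pV2 ?posrE // ler_wiXn2l // ltW.
have lower : fnorm (blk S *m A *m blk [set j]) <=
    n%:R * ((1 + n%:R * beta) / kappa ^+ n * eps).
  rewrite {1}blk_sum !mulmx_suml; apply: le_trans (fnorm_sum _ _ _) _.
  apply: le_trans (ler_sum _ bound) _; rewrite sumr_const -[leLHS]mulr_natl.
  apply: ler_wpM2r; last first.
    by rewrite ler_nat; rewrite (leq_trans _ mn) // -[leqRHS]card_ord max_card.
  rewrite mulr_ge0 // divr_ge0 ?(ltW (K_gt0 _)) //.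
  by rewrite addr_ge0 // mulr_ge0.
have -> : blk (j |: S) *m A *m blk (j |: S) =
    blk S *m A *m blk S +
    (blk S *m A *m blk [set j] + (blk S *m A *m blk [set j])^T).
  rewrite blkU // mulmxDl !mulmxDl !mulmxDr A0 add0r !trmx_mul !blk_tr AT mulmxA.
  by rewrite addrC (addrC (_ *m blk [set j])) -addrA.
apply: le_trans (fnormD _ _) _; rewrite /growth mulrDl lerD //.
apply: le_trans (fnormD _ _) _; rewrite fnorm_tr.
set k := _ / _ in lower *.
have -> : 2 * (n%:R * k) * eps = n%:R * (k * eps) + n%:R * (k * eps) by ring.
exact: lerD.
Qed.

(** The bound on the leading block is enlarged by [phase_lead], survives the phase by
    [fnorm_run_lead] and starts the next phase. No part of the word loses more than the whole, so
    [eps] serves throughout, and one [growth] is spent per column still to be swept. *)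
Lemma column_sweep_bound n S L W A (eps beta : R) : (m <= n)%N ->
  column_sweep S L -> map fst W = L -> rotations W -> sym_off_diag b A ->
  0 <= eps -> 0 <= beta -> fsq A - fsq (run W A) <= eps ^+ 2 ->
  fnorm (blk S *m A *m blk S) <= beta * eps ->
  fnorm (run W A) <= iter #|~: S| (growth n) beta * eps.
Proof.
move=> mn cS; elim: cS W A beta => {S L} [|S j tau L jS utau tauS _ IH] W A beta.
  case: W => // _ _ _ _ _ _.
  by rewrite setCT cards0 /= blkT mul1mx mulmx1.
case/map_cat_inv=> W1 [W2 [-> W1S W2S]] /rotations_cat[rW1 rW2] sA eps0 beta0.
rewrite run_cat => loss lead.
have loss1 := fsq_run A rW1; have loss2 := fsq_run (run W1 A) rW2.
have -> : #|~: S| = #|~: (j |: S)|.+1.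
  have jC : j \in ~: S by rewrite inE.
  by rewrite (cardsD1 j) jC add1n setCU setDE setIC.
rewrite iterSr; apply: IH => //.
- exact: (run_sym_off_diag rW1).
- exact: le_trans (growth_ge _ beta0).
- by move: loss loss1 loss2; set u := fsq _; set v := fsq _; set w := fsq _; lra.
apply: le_trans (fnorm_run_lead _ rW1 _) _ => [w wW|].
  have : w.1 \in [seq [set t; j] | t <- tau] by rewrite -W1S map_f.
  case/mapP=> t; rewrite tauS => tS ->; apply/subsetP => r; rewrite !inE.
  by case/orP=> /eqP->; rewrite ?tS ?eqxx ?orbT.
apply: (phase_lead mn eps0 beta0 jS utau tauS W1S rW1 sA _ lead).
by move: loss loss1 loss2; set u := fsq _; set v := fsq _; set w := fsq _; lra.
Qed.

End ColumnSweep.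

(** * Serial orderings as column-wise sweeps *)

Lemma column_sweep_enum m (e : seq 'I_m) (tau : 'I_m -> seq 'I_m) :
  uniq e -> (forall r, r \in e) ->
  (forall j s1 s2, e = s1 ++ j :: s2 -> perm_eq (tau j) s1) ->
  column_sweep finset.set0 (flatten [seq [seq [set t; j] | t <- tau j] | j <- e]).
Proof.
move=> ue eT tauP.
(* Induction on the columns [s2] still to be swept, [s1] being those already done. As [e] is an
   arbitrary enumeration, both increasing and decreasing index orders are covered. *)
suff gen s2 s1 : e = s1 ++ s2 ->
    column_sweep [set r in s1]
      (flatten [seq [seq [set t; j] | t <- tau j] | j <- s2]).
  have <- : [set r in [::]] = finset.set0 :> {set 'I_m} by apply/setP=> r; rewrite !inE.
  exact: gen.
elim: s2 s1 => [|j s2 IH] s1 Ee /=.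
  have -> : [set r in s1] = finset.setT.
    by apply/setP => r; rewrite !inE; have := eT r; rewrite Ee cats0.
  exact: column_sweep_done.
have tj := tauP _ _ _ Ee; move: (ue); rewrite Ee cat_uniq /=.
case/and4P=> us1 /norP[js1 _] _ _.
apply: column_sweep_phase => [|||].
- by rewrite inE.
- by rewrite (perm_uniq tj).
- by move=> r; rewrite inE (perm_mem tj).
have <- : [set r in rcons s1 j] = j |: [set r in s1].
  by apply/setP => r; rewrite !inE mem_rcons inE.
by apply: IH; rewrite cat_rcons.
Qed.

Lemma enum_prefix m (j : 'I_m) s1 s2 : enum 'I_m = s1 ++ j :: s2 ->
  forall r, (r \in s1) = (r < j)%N.
Proof.
move=> E r; have ue := enum_uniq 'I_m; move: (ue); rewrite E cat_uniq /=.
case/and4P=> _ /norP[js1 _] _ _.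
have jE : size s1 = j.
  by rewrite -[RHS]index_enum_ord E index_cat (negbTE js1) /= eqxx addn0.
rewrite -[X in (X < _)%N]index_enum_ord E index_cat -jE.
by case: ifP => [|_]; rewrite ?index_mem // ltnNge leq_addr.
Qed.

Lemma enum_suffix m (j : 'I_m) s1 s2 : enum 'I_m = s1 ++ j :: s2 ->
  forall r, (r \in s2) = (j < r)%N.
Proof.
move=> E r; have ue := enum_uniq 'I_m; move: (ue); rewrite E cat_uniq /= => U.
have := mem_enum 'I_m r; rewrite E mem_cat inE (enum_prefix E).
case: (ltngtP r j) => [rj|jr|/val_inj->] //=.
- move=> _; apply/negP => rs2; case/and4P: U => _ /norP[_ /hasPn/(_ _ rs2)] /=.
  by rewrite (enum_prefix E) rj.
- by case: eqP => // rj; rewrite rj ltnn in jr.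
by case/and4P: U => _ _ /negbTE.
Qed.

Lemma column_ordering_sweep m (O : seq ('I_m * 'I_m)) :
  column_ordering O -> column_sweep finset.set0 (map (@pivot m) O).
Proof.
case=> tau tauP ->.
have -> : map (@pivot m) (flatten [seq [seq (r, j) | r <- tau j] | j <- enum 'I_m]) =
    flatten [seq [seq [set t; j] | t <- tau j] | j <- enum 'I_m].
  by rewrite map_flatten -map_comp; congr flatten; apply: eq_map => j /=;
    rewrite -map_comp.
apply: column_sweep_enum => [||j s1 s2 E]; first exact: enum_uniq.
  by move=> r; rewrite mem_enum.
apply: perm_trans (tauP j) _; have := enum_uniq 'I_m; rewrite E cat_uniq.
case/and3P=> us1 _ _; apply: uniq_perm => //.
  by rewrite -E filter_uniq ?enum_uniq.
by move=> r; rewrite (enum_prefix E) -E mem_filter mem_enum andbT.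
Qed.

(** Pivots are unordered pairs, so along decreasing indices the row [i] pairs [i] with exactly the
    indices already seen, as a column does. *)
Lemma row_ordering_sweep m (O : seq ('I_m * 'I_m)) :
  row_ordering O -> column_sweep finset.set0 (map (@pivot m) O).
Proof.
case=> tau tauP ->.
have -> : map (@pivot m)
      (flatten [seq [seq (i, s) | s <- tau i] | i <- rev (enum 'I_m)]) =
    flatten [seq [seq [set t; i] | t <- tau i] | i <- rev (enum 'I_m)].
  rewrite map_flatten -map_comp; congr flatten; apply: eq_map => i /=.
  by rewrite -map_comp; apply: eq_map => s; rewrite /= /pivot finset.setUC.
apply: column_sweep_enum => [||j s1 s2 /(congr1 rev)].
- by rewrite rev_uniq enum_uniq.
- by move=> r; rewrite mem_rev mem_enum.
(* The indices that precede [j] in the reversed enumeration follow it in the increasing one. *)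
rewrite revK rev_cat rev_cons cat_rcons => E.
apply: perm_trans (tauP j) _; apply: (@perm_trans _ (rev s1)); last first.
  by rewrite perm_rev.
have := enum_uniq 'I_m; rewrite E cat_uniq /=.
case/and4P=> _ _ _ us1; apply: uniq_perm => //.
  by rewrite -E filter_uniq ?enum_uniq.
by move=> r; rewrite (enum_suffix E) -E mem_filter mem_enum andbT.
Qed.

(** * Contraction rates of serial and generalized serial orderings *)

Section SweepConstant.
Variables (R : rcfType) (N m : nat) (kappa : R).
Hypothesis kappa_gt0 : 0 < kappa.
Hypothesis kappa_le1 : kappa <= 1.

(** The iteration starts at [0] because the leading block on the empty set vanishes; [n] iterations
    dominate the [m] phases of a sweep. *)
Definition sweep_const n : R := iter n (growth kappa n) 0.

(* [|A'| <= C e] with [e^2 = |A|^2 - |A'|^2] gives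
   [|A'|^2 <= C^2 / (1 + C^2) |A|^2]. *)
Definition sweep_rate n : R := sweep_const n ^+ 2 / (1 + sweep_const n ^+ 2).

Lemma sweep_rate_ge0 n : 0 <= sweep_rate n.
Proof. by rewrite divr_ge0 ?addr_ge0 ?sqr_ge0. Qed.

Lemma sweep_rate_lt1 n : sweep_rate n < 1.
Proof.
have C0 := sqr_ge0 (sweep_const n).
by rewrite ltr_pdivrMr ?mul1r ?ltr_pwDl // lerDr.
Qed.

Lemma iter_growth_homo n k l : (k <= l)%N ->
  0 <= iter k (growth kappa n) 0 <= iter l (growth kappa n) 0.
Proof.
have G0 i : 0 <= iter i (growth kappa n) 0.
  by elim: i => //= i IH; apply: le_trans IH (growth_ge _ _ IH).
move=> /subnK<-; rewrite G0 /=; elim: (l - k)%N => //= i IH.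
by apply: le_trans IH _; rewrite growth_ge.
Qed.

Lemma contracts_column_sweep (b : 'I_N -> 'I_m) n S : (m <= n)%N ->
  column_sweep finset.set0 S -> contracts b kappa (sweep_rate n) S.
Proof.
move=> mn cS W A rW WS sA.
have loss : 0 <= fsq A - fsq (run b W A) by rewrite subr_ge0 (fsq_run A rW).
(* Taking the root of the actual loss makes the loss hypothesis of [column_sweep_bound] an
   equality. *)
set e := Num.sqrt (fsq A - fsq (run b W A)).
have e2 : e ^+ 2 = fsq A - fsq (run b W A) by rewrite sqr_sqrtr.
have := @column_sweep_bound R N m b kappa kappa_gt0 kappa_le1 n _ _ W A e 0
  mn cS WS rW sA (sqrtr_ge0 _) (lexx _).
rewrite e2 lexx => /(_ isT); rewrite blk0 mul0mx mulmx0 fnorm0 mul0r.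
move=> /(_ (lexx _)); rewrite finset.setC0 cardsT card_ord => bnd.
have {bnd} bnd : fnorm (run b W A) <= sweep_const n * e.
  apply: le_trans bnd _; rewrite ler_wpM2r ?sqrtr_ge0 //.
  by case/andP: (iter_growth_homo n mn).
have /andP[C0 _] := iter_growth_homo n (leqnn n).
move: bnd; rewrite fnorm_le ?mulr_ge0 ?sqrtr_ge0 // exprMn e2 => bnd.
have C2 : 0 < 1 + sweep_const n ^+ 2 by rewrite ltr_pwDl ?sqr_ge0.
rewrite mulrAC ler_pdivlMr //; move: bnd.
by set u := fsq _; set v := fsq A; set c := _ ^+ 2; lra.
Qed.

Lemma contracts_serial (b : 'I_N -> 'I_m) n O : (m <= n)%N ->
  serial_ordering O -> contracts b kappa (sweep_rate n) (sweeps 1 O).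
Proof.
move=> mn; rewrite sweepsS cats0 => -[[cO|rO]|[cO|rO]].
- exact/contracts_column_sweep/column_ordering_sweep.
- exact/contracts_column_sweep/row_ordering_sweep.
- rewrite -[map _ O]revK -map_rev; apply: contracts_rev (sweep_rate_ge0 _) _.
  exact/contracts_column_sweep/column_ordering_sweep.
- rewrite -[map _ O]revK -map_rev; apply: contracts_rev (sweep_rate_ge0 _) _.
  exact/contracts_column_sweep/row_ordering_sweep.
Qed.

(** One sweep of [O''] contracts, and [d] further sweeps pay for the shifts. The relabelling is
    undone at whichever end of the chain it stands, which is harmless as the rate does not depend on
    [b]. *)
Lemma contracts_generalized_serial (b : 'I_N -> 'I_m) n O O' O'' (q : 'S_m) d :
  (m <= n)%N -> serial_ordering O'' ->
  (O' = relabel q O /\ weakly_equivalent d O' O'') \/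
  (weakly_equivalent d O O' /\ O'' = relabel q O') ->
  contracts b kappa (sweep_rate n) (sweeps d.+1 O).
Proof.
move=> mn sO'' [[-> [be ch]]|[[be ch] EO'']].
  apply: (@contracts_relabel _ _ _ _ _ _ q).
  exact/(contracts_chain (sweep_rate_ge0 _) ch (k := 1))/contracts_serial.
apply: (contracts_chain (sweep_rate_ge0 _) ch (k := 1)).
apply: (@contracts_relabel _ _ _ _ _ _ q); rewrite -EO''.
exact: contracts_serial.
Qed.

End SweepConstant.

(** * Smallest singular value *)

Section Rayleigh.
Variable R : realType.

Lemma fsq_mulmx_bound m n (A : 'M[R]_(m, n)) :
  exists2 C : R, 0 < C & forall x : 'rV_m, fsq (x *m A) <= C ^+ 2 * fsq x.
Proof.
set s := \sum_j fsq (col j A).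
have s0 : 0 <= s by apply: sumr_ge0 => j _; exact: fsq_ge0.
(* The squared norm grows by at most the factor [s]; [1 + s] is positive and its square is at least
   [s]. *)
exists (1 + s); first by rewrite ltr_pwDl.
move=> x; apply: (@le_trans _ _ (s * fsq x)).
  rewrite mulr_suml fdotE big_ord1; apply: ler_sum => j _.
  have -> : (x *m A) 0 j = fdot x^T (col j A).
    rewrite fdotE mxE; apply: eq_bigr => i _.
    by rewrite big_ord1 !mxE.
  by rewrite -expr2 mulrC -(fsq_tr x) cauchy_schwarz.
by rewrite ler_wpM2r ?fsq_ge0 //; have := sqr_ge0 s; nra.
Qed.

(* A positive semidefinite invertible matrix is bounded below: apply
   Cauchy-Schwarz for the form [x P y^T] with [y = x P^-1]. *)
Lemma psd_unit_bound n (P : 'M[R]_n) : P^T = P ->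
  (forall x : 'rV_n, 0 <= fdot (x *m P) x) -> P \in unitmx ->
  exists2 c, 0 < c & forall x : 'rV_n, c * fsq x <= fdot (x *m P) x.
Proof.
move=> PT P0 Pu; have [C C0 HC] := fsq_mulmx_bound (invmx P).
have form (x y : 'rV_n) : fdot (x *m P) y ^+ 2 <= fdot (x *m P) x * fdot (y *m P) y.
  have sym (u v : 'rV_n) : fdot (u *m P) v = fdot (v *m P) u.
    by rewrite fdot_mulr PT fdotC.
  have H (t : R) : 0 <= fdot (x *m P) x + 2 * t * fdot (x *m P) y +
      t ^+ 2 * fdot (y *m P) y.
    have := P0 (x + t *: y).
    rewrite mulmxDl -scalemxAl !(fdotDl, fdotDr, fdotZl, fdotZr) (sym y x).
    by move/le_trans; apply; rewrite le_eqVlt; apply/orP; left; apply/eqP; ring.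
  set a := fdot (x *m P) x in H *; set b := fdot (x *m P) y in H *.
  set c := fdot (y *m P) y in H *.
  have c0 : 0 <= c by exact: P0.
  have [cE|cN] := eqVneq c 0.
    have [->|bN] := eqVneq b 0; first by rewrite expr0n cE mulr0.
    (* With no quadratic term left, this parameter makes the polynomial equal to [-1]. *)
    have := H (- (a + 1) / (2 * b)); rewrite cE mulr0 addr0.
    have -> : 2 * (- (a + 1) / (2 * b)) * b = - (a + 1) by field.
    by lra.
  have c_gt0 : 0 < c by rewrite lt_def cN.
  (* The minimizer of the quadratic polynomial. *)
  have := H (- b / c).
  have -> : a + 2 * (- b / c) * b + (- b / c) ^+ 2 * c = a - b ^+ 2 / c by field.
  by rewrite subr_ge0 ler_pdivrMr.
exists C^-1; first by rewrite invr_gt0.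
move=> x; rewrite mulrC ler_pdivrMr //.
have [x0|xN] := eqVneq (fsq x) 0; first by rewrite x0 mulr_ge0 // ltW.
have x_gt0 : 0 < fsq x by rewrite lt_def xN fsq_ge0.
rewrite -(ler_pM2r x_gt0) -expr2.
have yP : x *m invmx P *m P = x by rewrite mulmxKV.
have := form (x *m invmx P) x; rewrite yP => /le_trans; apply.
rewrite mulrC -mulrA ler_wpM2l ?P0 //.
have CS := cauchy_schwarz x (x *m invmx P).
have n0 : 0 <= C * fsq x by rewrite mulr_ge0 ?fsq_ge0 // ltW.
case: (lerP (fdot x (x *m invmx P)) 0) => [H|pos]; first exact: (le_trans H n0).
rewrite -(@ler_sqr _ _ (C * fsq x)) ?nnegrE ?(ltW pos) //.
rewrite exprMn; apply: le_trans CS _.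
by rewrite mulrC expr2 mulrA ler_wpM2r ?fsq_ge0.
Qed.

(** The eigenvalue is the supremum of the lower bounds of the Rayleigh quotient. Were [M] minus this
    supremum invertible, it would be bounded below by some [c > 0], and [sup T + c] would be a lower
    bound too. *)
Lemma min_eigenvalue n (M : 'M[R]_n) : (0 < n)%N -> M^T = M ->
  (forall x : 'rV_n, 0 <= fdot (x *m M) x) ->
  exists t, [/\ 0 <= t, eigenvalue M t
    & forall x : 'rV_n, t * fsq x <= fdot (x *m M) x].
Proof.
move=> n_gt0 MT M0.
pose T : classical_sets.set R :=
  fun t => forall x : 'rV_n, t * fsq x <= fdot (x *m M) x.
have T0 : T 0 by move=> x; rewrite mul0r.
have e1 : fsq (delta_mx 0 (Ordinal n_gt0) : 'rV[R]_n) = 1.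
  rewrite fdotE big_ord1 (bigD1 (Ordinal n_gt0)) //= big1 => [|i /negbTE ni].
    by rewrite addr0 !mxE !eqxx mulr1.
  by rewrite !mxE ni andbF mulr0.
have Tub : has_sup T.
  split; first by exists 0.
  by eexists => t /(_ (delta_mx 0 (Ordinal n_gt0))); rewrite e1 mulr1; exact.
have supT : T (sup T).
  move=> x; have [x0|xN] := eqVneq (fsq x) 0; first by rewrite x0 mulr0 M0.
  have x_gt0 : 0 < fsq x by rewrite lt_def xN fsq_ge0.
  rewrite -ler_pdivlMr //; apply: ge_sup; first by exists 0.
  by move=> t Tt; rewrite ler_pdivlMr.
exists (sup T); split=> //.
  by apply: ub_le_sup => //; case: Tub.
set P := M - (sup T)%:M.
have qP (x : 'rV_n) : fdot (x *m P) x = fdot (x *m M) x - sup T * fsq x.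
  by rewrite mulmxBr mul_mx_scalar fdotDl fdotNl fdotZl.
rewrite /eigenvalue /eigenspace kermx_eq0 row_free_unit -/P; apply/negP => Pu.
have PT : P^T = P by rewrite /P linearB /= MT tr_scalar_mx.
have [|c c0 Hc] := psd_unit_bound PT _ Pu.
  by move=> x; rewrite qP subr_ge0.
have : sup T + c <= sup T.
  apply: ub_le_sup; first by case: Tub.
  by move=> x; have := Hc x; rewrite qP; lra.
by lra.
Qed.

(** The root of the least eigenvalue of [U^T *m U] is a singular value, hence at least the infimum
    [sigma_min U]. For row vectors, [x *m U^T] is the transpose of [U *m x^T]. *)
Lemma sigma_min_bound n (U : 'M[R]_n) (k : R) : (0 < n)%N -> 0 < k ->
  k <= sigma_min U -> forall x : 'rV_n, k ^+ 2 * fsq x <= fsq (x *m U^T).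
Proof.
move=> n_gt0 k0 ks x.
have UT : (U^T *m U)^T = U^T *m U by rewrite trmx_mul trmxK.
have q (y : 'rV_n) : fdot (y *m (U^T *m U)) y = fsq (y *m U^T).
  by rewrite mulmxA fdot_mulr.
have [|t [t0 et Ht]] := min_eigenvalue n_gt0 UT.
  by move=> y; rewrite q fsq_ge0.
have kt : k <= Num.sqrt t.
  apply: le_trans ks _; apply: ge_inf; first by exists 0 => s [].
  by split; rewrite ?sqrtr_ge0 ?sqr_sqrtr.
rewrite -q; apply: le_trans (Ht x); rewrite ler_wpM2r ?fsq_ge0 //.
by rewrite -(sqr_sqrtr t0) ler_sqr ?nnegrE ?sqrtr_ge0 // ltW.
Qed.

(** The bound makes [V] invertible. With [z = x V^-1] the product of [x *m V^T] and [z] is [fsq x];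
    Cauchy-Schwarz is then combined with the bound at [z]. *)
Lemma lower_bound_tr n (V : 'M[R]_n) (k : R) : 0 < k ->
  (forall x : 'rV_n, k ^+ 2 * fsq x <= fsq (x *m V)) ->
  forall x : 'rV_n, k ^+ 2 * fsq x <= fsq (x *m V^T).
Proof.
move=> k0 HV x; have k2 : 0 < k ^+ 2 by rewrite exprn_gt0.
have Vu : V \in unitmx.
  rewrite -row_free_unit -kermx_eq0; apply/eqP/row_matrixP => i.
  have : k ^+ 2 * fsq (row i (kermx V)) <= 0.
    by apply: le_trans (HV _) _; rewrite -row_mul mulmx_ker row0 /fdot mulmx0 mxtrace0.
  rewrite pmulr_rle0 // row0 => r0; apply/eqP; rewrite -fsq_eq0.
  by rewrite eq_le r0 fsq_ge0.
have [x0|xN] := eqVneq (fsq x) 0; first by rewrite x0 mulr0 fsq_ge0.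
have x_gt0 : 0 < fsq x by rewrite lt_def xN fsq_ge0.
set z := x *m invmx V; have zV : z *m V = x by rewrite mulmxKV.
have CS := cauchy_schwarz (x *m V^T) z.
rewrite fdot_mulr trmxK zV in CS.
have := HV z; rewrite zV => kz.
rewrite -(ler_pM2r x_gt0) -mulrA -expr2.
apply: le_trans (ler_wpM2l (ltW k2) CS) _.
by rewrite mulrCA ler_wpM2l ?fsq_ge0.
Qed.

Lemma lower_bound_mulmx n l (V : 'M[R]_n) (k : R) (X : 'M[R]_(l, n)) : 0 <= k ->
  (forall x : 'rV_n, k ^+ 2 * fsq x <= fsq (x *m V)) ->
  k * fnorm X <= fnorm (X *m V).
Proof.
move=> k0 HV; rewrite -(@ler_sqr R) ?nnegrE ?mulr_ge0 ?fnorm_ge0 //.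
have rows r (Y : 'M[R]_(l, r)) : fsq Y = \sum_i fsq (row i Y).
  rewrite fdotE; apply: eq_bigr => i _; rewrite fdotE big_ord1.
  by apply: eq_bigr => j _; rewrite !mxE.
rewrite exprMn !fnorm_sqr !rows mulr_sumr; apply: ler_sum => i _.
by rewrite row_mul HV.
Qed.

End Rayleigh.

(** * Elementary block matrices *)

Section BlockMatrices.
Variables (R : realType) (m : nat) (p : m.-tuple nat).
Local Notation N := (\sum_(i < m) tnth p i)%N.
Implicit Types A : 'M[R]_N.

Let b : 'I_N -> 'I_m := tagnat.sig1.
Local Notation blk := (blk R b).

(** The isometric embedding of the coordinates of block [r]; it turns [submxblock] into matrix
    products. *)
Definition block_incl r : 'M[R]_(N, tnth p r) :=
  colsub (tagnat.Rank r) 1%:M.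

Lemma submxblockE A r s :
  submxblock A r s = (block_incl r)^T *m A *m block_incl s.
Proof.
rewrite /block_incl mulmx_colsub mulmx1 trmx_mxsub trmx1 mul_rowsub_mx mul1mx.
by apply/matrixP => u v; rewrite !mxE.
Qed.

Lemma Rank_inj r : injective (@tagnat.Rank m (tnth p) r).
Proof.
move=> u v /(congr1 (@nat_of_ord _)); rewrite !tagnat.RankEsum => /addnI.
exact: val_inj.
Qed.

Lemma block_incl_tr_mul r : (block_incl r)^T *m block_incl r = 1%:M.
Proof.
rewrite -[(block_incl r)^T]mulmx1 -submxblockE; apply/matrixP => u v.
by rewrite !mxE (inj_eq (@Rank_inj r)).
Qed.

Lemma block_incl_mul_tr r : block_incl r *m (block_incl r)^T = blk [set r].
Proof.
apply/matrixP => u v; rewrite !mxE inE.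
have [ur|ur] := eqVneq (b u) r.
  have [w0 ->] : exists w, u = tagnat.Rank r w.
    by case: _ / ur; exists (tagnat.sig2 u); rewrite (tagnat.sig2K u).
  rewrite (bigD1 w0) //= [X in _ + X]big1 => [|w wu]; rewrite !mxE.
    by rewrite eqxx mul1r addr0 eq_sym.
  by rewrite (inj_eq (@Rank_inj r)) eq_sym (negbTE wu) mul0r.
rewrite mul0rn; apply: big1 => w _; rewrite !mxE.
by case: eqP => [E|_]; rewrite ?mul0r //; rewrite E /b tagnat.Rank1K eqxx in ur.
Qed.

Lemma block_incl_tr_blk r x :
  (block_incl r)^T *m blk x = if r \in x then (block_incl r)^T else 0.
Proof.
rewrite -[(block_incl r)^T]mul1mx -block_incl_tr_mul -!mulmxA [_ *m (_ *m blk x)]mulmxA.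
rewrite block_incl_mul_tr blkM; case: ifP => rx.
  by rewrite (setIidPl _) ?sub1set // block_incl_mul_tr.
by rewrite disjoint_setI0 ?disjoints1 ?rx // blk0 mulmx0.
Qed.

Lemma blk_block_incl r x :
  blk x *m block_incl r = if r \in x then block_incl r else 0.
Proof.
apply: trmx_inj; rewrite trmx_mul blk_tr block_incl_tr_blk.
by case: ifP => _ //; rewrite trmx0.
Qed.

Lemma block_incl_orth r s : r != s -> (block_incl r)^T *m block_incl s = 0.
Proof.
move=> rs; have E : blk [set s] *m block_incl s = block_incl s.
  by rewrite blk_block_incl inE eqxx.
by rewrite -E mulmxA block_incl_tr_blk inE (negbTE rs) mul0mx.
Qed.

Lemma annihilate_pivotE i j A :
  annihilate_pivot i j A = kill b (pivot (i, j)) A.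
Proof.
apply/matrixP => u v; rewrite /kill 2![in RHS]mxE blk_mulE mxE !inE -/b.
by do 2! case: (_ || _); rewrite /= ?mxE ?tagnat.sig2K ?mul0r ?mulr0 ?subr0 //
  mul1r mulr1 subrr.
Qed.

Lemma sym_zero_diagP A : sym_zero_diag A <-> sym_off_diag b A.
Proof.
split=> -[AT A0]; split=> // r.
  rewrite -block_incl_mul_tr -!mulmxA (mulmxA A) (mulmxA _^T) (mulmxA _^T).
  by rewrite -submxblockE A0 mul0mx mulmx0.
have := congr1 (fun M => (block_incl r)^T *m M *m block_incl r) (A0 r).
rewrite mulmx0 mul0mx !mulmxA block_incl_tr_blk -!mulmxA blk_block_incl.
by rewrite inE eqxx mulmxA -submxblockE.
Qed.

Section Elementary.
Variables (i j : 'I_m) (U : 'M[R]_(tnth p i + tnth p j)).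
Hypothesis ij : i != j.

Let Q : 'M[R]_(N, tnth p i + tnth p j) := row_mx (block_incl i) (block_incl j).

Let QTQ : Q^T *m Q = 1%:M.
Proof.
rewrite /Q tr_row_mx mul_col_row !block_incl_tr_mul !block_incl_orth //.
  by rewrite -scalar_mx_block.
by rewrite eq_sym.
Qed.

Let QQT : Q *m Q^T = blk (pivot (i, j)).
Proof.
rewrite /Q tr_row_mx mul_row_col !block_incl_mul_tr /pivot blkU //=.
by rewrite disjoints1 inE.
Qed.

Let outQ : blk (~: pivot (i, j)) *m Q = 0.
Proof.
rewrite /Q mul_mx_row !blk_block_incl !inE !eqxx orbT /=.
exact: row_mx0.
Qed.

Let QTout : Q^T *m blk (~: pivot (i, j)) = 0.
Proof. by apply: trmx_inj; rewrite trmx_mul trmxK blk_tr outQ trmx0. Qed.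

(** A closed form in place of the case analysis on blocks: the identity away from the pivot, and [U]
    transported to the pivot blocks by the isometry [Q]. *)
Lemma elementaryE :
  elementary U = blk (~: pivot (i, j)) + Q *m U *m Q^T.
Proof.
have ji : (j == i) = false by rewrite eq_sym (negbTE ij).
have iQ : (block_incl i)^T *m Q = row_mx 1%:M 0.
  by rewrite mul_mx_row block_incl_tr_mul block_incl_orth.
have jQ : (block_incl j)^T *m Q = row_mx 0 1%:M.
  by rewrite mul_mx_row block_incl_tr_mul block_incl_orth // ji.
have QT r : Q^T *m block_incl r = ((block_incl r)^T *m Q)^T.
  by rewrite trmx_mul trmxK.
have Q0 r : r \notin pivot (i, j) -> (block_incl r)^T *m Q = 0.
  rewrite !inE negb_or => /andP[ri rj].
  by rewrite mul_mx_row !block_incl_orth // row_mx0.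
have out r : r \in pivot (i, j) ->
    (block_incl r)^T *m blk (~: pivot (i, j)) = 0.
  by move=> rx; rewrite block_incl_tr_blk inE rx.
have ix : i \in pivot (i, j) by rewrite !inE eqxx.
have jx : j \in pivot (i, j) by rewrite !inE eqxx orbT.
apply/mxblockP => r s; rewrite mxblockK [RHS]submxblockE mulmxDr mulmxDl.
have -> : (block_incl r)^T *m (Q *m U *m Q^T) *m block_incl s =
    ((block_incl r)^T *m Q) *m U *m ((block_incl s)^T *m Q)^T.
  by rewrite -QT !mulmxA.
have U11 : row_mx 1%:M 0 *m U *m (row_mx 1%:M 0)^T = ulsubmx U.
  rewrite -{1}[U]submxK tr_row_mx mul_row_block mul_row_col !trmx0 trmx1.
  by rewrite !mul1mx !mul0mx !mulmx0 mulmx1 !addr0.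
have U12 : row_mx 1%:M 0 *m U *m (row_mx 0 1%:M)^T = ursubmx U.
  rewrite -{1}[U]submxK tr_row_mx mul_row_block mul_row_col !trmx0 trmx1.
  by rewrite !mul1mx !mul0mx !mulmx0 mulmx1 !addr0 add0r.
have U21 : row_mx 0 1%:M *m U *m (row_mx 1%:M 0)^T = dlsubmx U.
  rewrite -{1}[U]submxK tr_row_mx mul_row_block mul_row_col !trmx0 trmx1.
  by rewrite !mul1mx !mul0mx !mulmx0 mulmx1 !add0r addr0.
have U22 : row_mx 0 1%:M *m U *m (row_mx 0 1%:M)^T = drsubmx U.
  rewrite -{1}[U]submxK tr_row_mx mul_row_block mul_row_col !trmx0 trmx1.
  by rewrite !mul1mx !mul0mx !mulmx0 mulmx1 !add0r.
have [rx|rx] := boolP (r \in pivot (i, j)); last first.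
  rewrite Q0 // !mul0mx addr0 block_incl_tr_blk inE rx /=.
  move: rx; rewrite !inE negb_or => /andP[/negbTE-> /negbTE->] /=.
  by rewrite submxblockE mulmx1.
rewrite out // mul0mx add0r.
have [sx|sx] := boolP (s \in pivot (i, j)); last first.
  rewrite (Q0 s) // trmx0 mulmx0.
  have rs : r != s by apply: contraNneq sx => <-.
  move: sx; rewrite !inE negb_or => /andP[/negbTE-> /negbTE->].
  by rewrite !andbF submxblockE mulmx1 block_incl_orth.
move: rx sx; rewrite !inE => /orP[]/eqP-> /orP[]/eqP->.
- by rewrite eqxx /= conform_mx_id iQ U11.
- by rewrite !eqxx ji /= conform_mx_id iQ jQ U12.
- by rewrite !eqxx ji /= conform_mx_id iQ jQ U21.
- by rewrite !eqxx ji /= conform_mx_id jQ U22.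
Qed.

Lemma submxblock_elementary_ii : submxblock (elementary U) i i = ulsubmx U.
Proof. by rewrite mxblockK eqxx /= conform_mx_id. Qed.

Lemma submxblock_elementary_jj : submxblock (elementary U) j j = drsubmx U.
Proof. by rewrite mxblockK eqxx eq_sym (negbTE ij) /= conform_mx_id. Qed.

Lemma elementary_orth :
  orthogonal_mx U -> (elementary U)^T *m elementary U = 1%:M.
Proof.
move=> UU; have -> : (elementary U)^T = blk (~: pivot (i, j)) + Q *m U^T *m Q^T.
  by rewrite elementaryE linearD /= blk_tr !trmx_mul trmxK mulmxA.
rewrite elementaryE mulmxDl !mulmxDr blk_idem -!mulmxA QTout !mulmx0 add0r.
rewrite (mulmxA _ Q) outQ mul0mx addr0 (mulmxA Q^T) QTQ mul1mx (mulmxA U^T) UU.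
by rewrite mul1mx QQT blkC subrK.
Qed.

Lemma elementary_out :
  elementary U *m blk (~: pivot (i, j)) = blk (~: pivot (i, j)).
Proof. by rewrite elementaryE mulmxDl blk_idem -mulmxA QTout mulmx0 addr0. Qed.

(** The two diagonal blocks of [U] share their smallest singular value, so one inequality bounds
    both; [lower_bound_tr] passes between a block and its transpose. *)
Lemma elementary_rotation (rho : R) (k : R) : 0 < k ->
  (0 < tnth p i)%N -> (0 < tnth p j)%N ->
  k <= rho * gamma R p i j -> UBCE rho U ->
  rotation b k (pivot (i, j)) (elementary U).
Proof.
move=> k0 i0 j0 kg [UU sij sj].
have kj := le_trans kg sj; have ki : k <= sigma_min (ulsubmx U) by rewrite sij.
have bound r (V : 'M[R]_(tnth p r)) (E : 'M[R]_N) (X : 'M[R]_N) :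
    submxblock E r r = V ->
    (forall x : 'rV_(tnth p r), k ^+ 2 * fsq x <= fsq (x *m V)) ->
    k * fnorm (X *m blk [set r]) <= fnorm (X *m blk [set r] *m E *m blk [set r]).
  move=> EV HV; rewrite -!block_incl_mul_tr.
  have -> : X *m (block_incl r *m (block_incl r)^T) *m E *m
            (block_incl r *m (block_incl r)^T) =
            X *m block_incl r *m V *m (block_incl r)^T.
    by rewrite -EV submxblockE !mulmxA.
  have iso (Y : 'M[R]_(N, tnth p r)) : fnorm (Y *m (block_incl r)^T) = fnorm Y.
    by rewrite /fnorm fsq_isom_mulr // trmxK block_incl_tr_mul.
  by rewrite mulmxA !iso; apply: lower_bound_mulmx => //; exact: ltW.
have bi := sigma_min_bound i0 k0 ki; have bj := sigma_min_bound j0 k0 kj.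
have biT := lower_bound_tr k0 bi; have bjT := lower_bound_tr k0 bj.
rewrite !trmxK in biT bjT.
split; [exact: elementary_orth | exact: elementary_out | |] => r X.
  rewrite !inE => /orP[]/eqP->.
    exact: bound submxblock_elementary_ii biT.
  exact: bound submxblock_elementary_jj bjT.
rewrite !inE => /orP[]/eqP->.
  by apply: bound bi; rewrite -tr_submxblock submxblock_elementary_ii.
by apply: bound bj; rewrite -tr_submxblock submxblock_elementary_jj.
Qed.

End Elementary.
End BlockMatrices.

(** * Vectorization of symmetric matrices *)

Section Vectorization.
Variables (R : realType) (m : nat) (p : m.-tuple nat).
Local Notation N := (\sum_(i < m) tnth p i)%N.
Implicit Types A : 'M[R]_N.

Let b : 'I_N -> 'I_m := tagnat.sig1.
Let up := @upper_pair m.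

(** The column index [c] comes first because [vec] transposes each block before listing it. *)
Let block_pos k (c : 'I_(tnth p (up k).2)) (r : 'I_(tnth p (up k).1)) :
    'I_(vec_dim p) := tagnat.Rank k (mxvec_index c r).

Let vec_block_pos A k c r :
  vec A (@block_pos k c r) 0 = A (tagnat.Rank _ r) (tagnat.Rank _ c).
Proof.
have -> : vec A (block_pos c r) 0 = submxcol (vec A) k (mxvec_index c r) 0.
  by rewrite [RHS]mxE.
by rewrite mxcolK mxE mxvecE !mxE.
Qed.

(** Hides the encoding of [vec]: its coordinates correspond one to one to the entries above the
    diagonal blocks. *)
Lemma vec_positions : exists pos : 'I_(vec_dim p) -> 'I_N * 'I_N,
  [/\ injective pos, forall a, (b (pos a).1 < b (pos a).2)%N,
      forall u v, (b u < b v)%N -> exists a, pos a = (u, v)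
    & forall A a, vec A a 0 = A (pos a).1 (pos a).2].
Proof.
pose P a uv := exists k c r, a = @block_pos k c r /\
  uv = (tagnat.Rank (up k).1 r, tagnat.Rank (up k).2 c) :> 'I_N * 'I_N.
have exP a : exists uv, P a uv.
  rewrite -(tagnat.sig2K a); move: (tagnat.sig1 a) (tagnat.sig2 a) => k t.
  by case/mxvec_indexP: t => c r; eexists; exists k, c, r.
have [pos posP] := fin_all_exists exP.
exists pos; split.
- move=> a a'; have [k [c [r [-> ->]]]] := posP a.
  have [k' [c' [r' [-> ->]]]] := posP a' => E.
  have E1 : tagnat.Rank (up k).1 r = tagnat.Rank (up k').1 r' := congr1 fst E.
  have E2 : tagnat.Rank (up k).2 c = tagnat.Rank (up k').2 c' := congr1 snd E.
  have kk' : k = k'.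
    apply: (@upper_pair_inj m); rewrite -/up [LHS]surjective_pairing.
    rewrite [RHS]surjective_pairing; congr (_, _).
      by have := congr1 tagnat.sig1 E1; rewrite !tagnat.Rank1K.
    by have := congr1 tagnat.sig1 E2; rewrite !tagnat.Rank1K.
  case: _ / kk' c' r' {E} E1 E2 => c' r' /(@Rank_inj m p _ _ _)-> /(@Rank_inj m p _ _ _)->.
  by [].
- move=> a; have [k [c [r [_ ->]]]] := posP a.
  by rewrite /b !tagnat.Rank1K; apply: upper_pair_lt.
- move=> u v uv.
  have /tnthP[k Ek] : (b u, b v) \in in_tuple (upper_pairs m).
    by rewrite mem_upper_pairs.
  have [c [r Euv]] : exists c r,
      (u, v) = (tagnat.Rank (up k).1 r, tagnat.Rank (up k).2 c).
    rewrite /up /upper_pair -Ek /=; exists (tagnat.sig2 v), (tagnat.sig2 u).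
    by rewrite !tagnat.sig2K.
  exists (block_pos c r).
  have [k' [c' [r' [E ->]]]] := posP (block_pos c r).
  (* [pos] was obtained by choice; evaluating at the matrix unit of [(u, v)] identifies its value
     here. *)
  have := vec_block_pos (delta_mx u v) c r; rewrite E vec_block_pos.
  case: Euv => <- <-; rewrite !mxE !eqxx /=.
  by case: eqP => [->|_]; case: eqP => [->|_] //= /esym/eqP; rewrite oner_eq0.
- move=> A a; have [k [c [r [-> ->]]]] := posP a.
  exact: vec_block_pos.
Qed.

(** By symmetry each entry above the diagonal blocks occurs a second time below them. Contraction in
    the Frobenius norm thus transfers to [vec]. *)
Lemma fsq_vec A : sym_zero_diag A -> fsq A = 2 * fsq (vec A).
Proof.
move=> /sym_zero_diagP[AT A0]; have [pos [pos_inj pos_lt pos_onto vecE]] := vec_positions.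
have diag u v : b u = b v -> A u v = 0.
  move=> uv; have := congr1 (fun M : 'M_N => M u v) (A0 (b u)).
  by rewrite blk_mulE !inE; rewrite /b in uv *; rewrite -uv eqxx mul1r mulr1 mxE.
have lower : \sum_(x : 'I_N * 'I_N | (b x.1 < b x.2)%N) A x.1 x.2 * A x.1 x.2 =
    fsq (vec A).
  rewrite fdotE (eq_bigl (mem (pos @: setT))) => [|[u v] /=].
    rewrite big_imset /=; last by move=> x y _ _; exact: pos_inj.
    apply: eq_big => [a|a _]; first by rewrite inE.
    by rewrite big_ord1 vecE.
  apply/idP/imsetP => [/pos_onto[a <-]|[a _ E]]; first by exists a.
  by have := pos_lt a; rewrite -E.
rewrite fdotE pair_big /= (bigID (fun x => b x.1 < b x.2)%N) /= lower.
rewrite (bigID (fun x => b x.2 < b x.1)%N) /= [X in _ + (_ + X)]big1 ?addr0; last first.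
  move=> x /andP[]; rewrite -!leqNgt => x1 x2; rewrite diag ?mul0r //.
  by apply/val_inj/eqP; rewrite eqn_leq x1 x2.
have swapK : involutive (fun x : 'I_N * 'I_N => (x.2, x.1)) by case.
rewrite (reindex_inj (inv_inj swapK)) /= mulr_natl mulr2n; congr (_ + _).
have AS u v : A u v = A v u by rewrite -{1}AT mxE.
by rewrite -lower; apply: eq_big => [x|x _]; [case: ltngtP | rewrite AS].
Qed.

(** The spectral norm ranges over all vectors, so each of them has to come from an admissible
    matrix. *)
Lemma vec_onto (x : 'cV[R]_(vec_dim p)) :
  exists2 A : 'M[R]_N, sym_zero_diag A & vec A = x.
Proof.
have [pos [pos_inj pos_lt pos_onto vecE]] := vec_positions.
pose D (u v : 'I_N) : 'M[R]_N := delta_mx u v + delta_mx v u.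
exists (\sum_a x a 0 *: D (pos a).1 (pos a).2).
  apply/sym_zero_diagP; split.
    rewrite linear_sum /=; apply: eq_bigr => a _.
    by rewrite linearZ /= linearD /= !trmx_delta addrC.
  move=> r; rewrite mulmx_sumr mulmx_suml; apply: big1 => a _.
  apply/matrixP => u v; rewrite blk_mulE !inE !mxE.
  have [ur|] := eqVneq (tagnat.sig1 u) r; last by rewrite !mul0r.
  have [vr|] := eqVneq (tagnat.sig1 v) r; last by rewrite mulr0.
  have := pos_lt a; rewrite mul1r mulr1.
  case: (pos a) => u' v' /= lt.
  case: eqP => [uE|_]; case: eqP => [vE|_] /=;
    case: eqP => [uE'|_]; case: eqP => [vE'|_] /=; rewrite ?addr0 ?mulr0 //;
    exfalso; move: lt; rewrite /b -?uE -?vE -?uE' -?vE' ?ur ?vr ltnn //.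
apply/matrixP => a z; rewrite ord1 vecE summxE (bigD1 a) //= [X in _ + X]big1 => [|a' a'a].
  rewrite addr0 !mxE !eqxx /=; have := pos_lt a.
  case: eqP => [->|_]; last by rewrite addr0 mulr1.
  by rewrite ltnn.
rewrite !mxE.
have := pos_lt a; have := pos_lt a'.
move: a'a; rewrite -(inj_eq pos_inj).
case: (pos a) (pos a') => [u v] [u' v'] /=; rewrite xpair_eqE.
case: (eqVneq u' u) => [->|uu]; case: (eqVneq v' v) => [->|vv] //= _.
(* The only case left is that [pos a'] is [pos a] with its indices exchanged; they cannot both lie
   above the diagonal blocks. *)
all: case: eqP => [->|_]; case: eqP => [->|_] /=; rewrite ?addr0 ?mulr0 //.
all: by move=> /ltn_trans/[apply]; rewrite ltnn.
Qed.

End Vectorization.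

(** * Jacobi operators *)

Section UniformBound.
Variable R : realType.

(** A lower bound for all [rho * gamma R p i j]: both part sizes are replaced by [n] and the [-1] is
    dropped. The cap at [1] provides the hypothesis [kappa <= 1] of the sweep estimates. *)
Definition uniform_bound (n : nat) (rho : R) : R :=
  Num.min 1 (rho * (3 / Num.sqrt ((4 ^+ n + 6 * n%:R) * (n%:R + 1)))).

Let radicand_gt0 n : 0 < (4 ^+ n + 6 * n%:R) * (n%:R + 1) :> R.
Proof.
apply: mulr_gt0; last by rewrite ltr_wpDl.
by rewrite ltr_pwDl ?exprn_gt0 ?mulr_ge0.
Qed.

Lemma uniform_bound_gt0 n rho : 0 < rho -> 0 < uniform_bound n rho.
Proof.
by move=> rho0; rewrite lt_min ltr01 mulr_gt0 // divr_gt0 // sqrtr_gt0.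
Qed.

Lemma uniform_bound_le1 n rho : uniform_bound n rho <= 1.
Proof. by rewrite ge_min lexx. Qed.

Lemma uniform_bound_gamma n rho m (p : m.-tuple nat) i j : 0 <= rho ->
  (tnth p i <= n)%N -> (tnth p j <= n)%N -> (0 < tnth p j)%N ->
  uniform_bound n rho <= rho * gamma R p i j.
Proof.
move=> rho0 pin pjn pj0; rewrite /uniform_bound ge_min; apply/orP; right.
rewrite ler_wpM2l // /gamma ler_wpM2l //.
have pj1 : 1 <= (tnth p j)%:R :> R by rewrite ler1n.
have pi4 : 1 <= 4 ^+ tnth p i :> R by rewrite exprn_ege1 // ler1n.
have pi4n : 4 ^+ tnth p i <= 4 ^+ n :> R by rewrite ler_weXn2l // ler1n.
have pjnR : (tnth p j)%:R <= n%:R :> R by rewrite ler_nat.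
have pos : 0 < (4 ^+ tnth p i + 6 * (tnth p j)%:R - 1) * ((tnth p j)%:R + 1) :> R.
  by rewrite mulr_gt0 //; lra.
rewrite lef_pV2 ?posrE ?sqrtr_gt0 // ler_sqrt.
  by apply: ler_pM; lra.
exact: ltW.
Qed.

End UniformBound.

Section JacobiOperators.
Variables (R : realType) (m : nat) (p : m.-tuple nat).
Local Notation N := (\sum_(i < m) tnth p i)%N.
Let b : 'I_N -> 'I_m := tagnat.sig1.
Variables (n : nat) (rho : R).
Hypothesis p_part : is_partition n p.
Hypothesis rho_gt0 : 0 < rho.
Local Notation kappa := (uniform_bound n rho).

Lemma partition_part_le i : (tnth p i <= n)%N.
Proof. by case: p_part => _ _ <-; rewrite (bigD1 i) //= leq_addr. Qed.

Lemma partition_size_le : (m <= n)%N.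
Proof.
case: p_part => _ p0 <-; rewrite -[X in (X <= _)%N]card_ord -sum1_card.
exact: leq_sum.
Qed.

(** An annihilator is specified only on symmetric matrices with zero diagonal blocks; steps preserve
    this class, so the factors compose. *)
Lemma jacobi_operator_word (O : seq ('I_m * 'I_m)) (J : 'M[R]_(vec_dim p)) :
  (forall x, x \in O -> x.1 != x.2) -> jacobi_operator rho O J ->
  exists W, [/\ rotations b kappa W, map fst W = map (@pivot m) O
    & forall A, sym_zero_diag A -> J *m vec A = vec (run b W A)].
Proof.
case: (p_part) => _ p0 _.
elim: O J => [|[i j] O IH] J neq /=.
  by move=> ->; exists [::]; split=> // A _; rewrite mul1mx.
case=> U [M [J' [UB MU JJ' ->]]].
have [|W [rW WO JW]] := IH J' _ JJ'.
  by move=> x xO; apply: neq; rewrite inE xO orbT.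
have ij : i != j by apply: (neq (i, j)); rewrite inE eqxx.
have rU : rotation b kappa (pivot (i, j)) (elementary U).
  apply: (elementary_rotation ij _ (p0 i) (p0 j) _ UB).
    exact: uniform_bound_gt0.
  by apply: uniform_bound_gamma; rewrite ?partition_part_le ?ltW.
exists ((pivot (i, j), elementary U) :: W); split.
- exact/rotations_cons.
- by rewrite /= WO.
move=> A sA; rewrite -mulmxA MU // annihilate_pivotE JW //.
by apply/sym_zero_diagP; apply: step_sym_off_diag rU _; apply/sym_zero_diagP.
Qed.

Lemma jacobi_product_word (O : seq ('I_m * 'I_m)) d
    (J : 'I_d -> 'M[R]_(vec_dim p)) :
  (forall x, x \in O -> x.1 != x.2) -> (forall k, jacobi_operator rho O (J k)) ->
  exists W, [/\ rotations b kappa W, map fst W = sweeps d O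
    & forall A, sym_zero_diag A -> (\prod_k J k) *m vec A = vec (run b W A)].
Proof.
move=> neq; elim: d J => [|d IH] J HJ.
  by exists [::]; split=> // A _; rewrite big_ord0 mul1mx.
(* The last factor of the product acts first, so its word is put in front. *)
have [W1 [rW1 W1O HW1]] := jacobi_operator_word neq (HJ ord_max).
have [W2 [rW2 W2O HW2]] := IH _ (fun k => HJ (widen_ord (leqnSn d) k)).
exists (W1 ++ W2); split.
- exact/rotations_cat.
- by rewrite map_cat W1O W2O.
move=> A sA; rewrite big_ord_recr -mulmxA HW1 // HW2 ?run_cat //.
by apply/sym_zero_diagP; apply: run_sym_off_diag rW1 _; apply/sym_zero_diagP.
Qed.

Lemma enormE k (x : 'cV[R]_k) : enorm x = fnorm x.
Proof.
rewrite /fnorm fdotE; congr Num.sqrt; apply: eq_bigr => i _.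
by rewrite big_ord1 expr2.
Qed.

Lemma spectral_norm_le k l (A : 'M[R]_(k, l)) (c : R) : 0 <= c ->
  (forall x : 'cV_l, fsq (A *m x) <= c * fsq x) ->
  spectral_norm A <= Num.sqrt c.
Proof.
move=> c0 HA; apply: ge_sup.
  by exists (enorm (A *m 0)), 0 => //=; rewrite enormE fnorm0.
move=> _ [x /= x1 <-]; rewrite !enormE in x1 *.
apply: (@le_trans _ _ (Num.sqrt c * fnorm x)).
  by rewrite -sqrtrM // ler_sqrt ?mulr_ge0 ?fsq_ge0.
by rewrite ler_piMr ?sqrtr_ge0.
Qed.

Lemma spectral_norm_jacobi (O O' O'' : seq ('I_m * 'I_m)) (q : 'S_m) d
    (J : 'I_d.+1 -> 'M[R]_(vec_dim p)) :
  pivot_sequence O -> serial_ordering O'' ->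
  (O' = relabel q O /\ weakly_equivalent d O' O'') \/
  (weakly_equivalent d O O' /\ O'' = relabel q O') ->
  (forall k, jacobi_operator rho O (J k)) ->
  spectral_norm (\prod_k J k) <= Num.sqrt (sweep_rate kappa n).
Proof.
move=> pO sO'' ch HJ; have k0 := uniform_bound_gt0 n rho_gt0.
have k1 := uniform_bound_le1 n rho.
have neq x : x \in O -> x.1 != x.2 by rewrite pO neq_ltn => ->.
have [W [rW WO HW]] := jacobi_product_word neq HJ.
have cO : contracts b kappa (sweep_rate kappa n) (sweeps d.+1 O).
  apply: (contracts_generalized_serial k0 k1 _ sO'' ch).
  exact: partition_size_le.
apply: (@spectral_norm_le (vec_dim p) (vec_dim p)) => [|x].
  exact: sweep_rate_ge0.
have [A sA <-] := vec_onto x.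
have sA' := proj1 (sym_zero_diagP A) sA.
have sW : sym_zero_diag (run b W A).
  by apply/sym_zero_diagP; apply: run_sym_off_diag rW _.
(* The factor [2] of [fsq_vec] appears on both sides and cancels. *)
have := cO W A rW WO sA'; rewrite HW // (fsq_vec sA) (fsq_vec sW).
by rewrite mulrCA ler_pM2l.
Qed.

End JacobiOperators.

Theorem theorem3p9 (R : realType) :
  exists (mu : seq nat -> R -> R) (mu_tilde : nat -> R -> R),
    (forall (n m : nat) (sigma : m.-tuple nat) (rho : R),
        is_partition n sigma -> 0 < rho <= 1 ->
        0 <= mu sigma rho /\ mu sigma rho < mu_tilde n rho /\
        mu_tilde n rho < 1) /\
    (forall (n m : nat) (p : m.-tuple nat) (rho : R)
            (O O' O'' : seq ('I_m * 'I_m)) (q : 'S_m) (d : nat),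
        is_partition n p -> 0 < rho <= 1 ->
        generalized_serial_ordering O ->
        pivot_sequence O' -> serial_ordering O'' ->
        (O' = relabel q O /\ weakly_equivalent d O' O'') \/
        (weakly_equivalent d O O' /\ O'' = relabel q O') ->
        forall J : 'I_d.+1 -> 'M[R]_(vec_dim p),
          (forall k, jacobi_operator rho O (J k)) ->
          spectral_norm (\prod_(k < d.+1) J k) <=
            mu (permute_partition p q) rho /\
          0 <= mu (permute_partition p q) rho /\
          mu (permute_partition p q) rho < mu_tilde n rho /\
          mu_tilde n rho < 1).
Proof.
pose c n (rho : R) := Num.sqrt (sweep_rate (uniform_bound n rho) n).
(* [mu] uses only the sum of the partition, which is [n] and is invariant under [q]; the midpoint
   between [c n rho] and [1] yields both strict inequalities. *)
exists (fun s rho => c (sumn s) rho), (fun n rho => (1 + c n rho) / 2).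
have c_bounds n rho : 0 <= c n rho /\ c n rho < (1 + c n rho) / 2 /\
    (1 + c n rho) / 2 < 1.
  have c0 : 0 <= c n rho by exact: sqrtr_ge0.
  have c1 : c n rho < 1.
    by rewrite -[X in _ < X]sqrtr1 ltr_sqrt ?ltr01 // sweep_rate_lt1.
  by split=> //; lra.
have sumn_part n m (s : m.-tuple nat) : is_partition n s -> sumn s = n.
  by case=> _ _ <-; rewrite sumnE big_tuple.
split=> [n m s rho /sumn_part-> _|]; first exact: c_bounds.
move=> n m p rho O O' O'' q d pn /andP[rho0 _] [pO _] _ sO'' ch J HJ.
have -> : sumn (permute_partition p q) = n.
  rewrite -(sumn_part _ _ _ pn) !sumnE !big_tuple [RHS](reindex_inj (@perm_inj _ q)).
  by apply: eq_bigr => i _; rewrite tnth_mktuple.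
split; last exact: c_bounds.
by have := spectral_norm_jacobi pn rho0 pO sO'' ch HJ.
Qed.
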